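(* Let $W$ be the affine Weyl group of type $\widetilde{A}_2$ (setting and notation as in the context). For every $x\in W\setminus\{\mathrm{id}\}$ and every $y\in W$, \[ [x,y]=\{z\in W \;:\; \operatorname{cen}(z)\in \mathcal{C}_y \ \text{ and } \ \operatorname{cen}(z)\notin \mathcal{St}(x)^{\circ}\}, \] where $[x,y]=\{z\in W: x\le z\le y\}$ is the Bruhat interval and $\mathcal{St}(x)^{\circ}$ denotes the interior of $\mathcal{St}(x)$.
   Context: Setting. $E$ is a real Euclidean plane with inner product $(-,-)$. $\Phi\subset E$ is a root system of type $A_2$ with simple roots $\alpha_1,\alpha_2$, $(\alpha_i,\alpha_i)=2$, $(\alpha_1,\alpha_2)=-1$, $\rho=\alpha_1+\alpha_2$, positive roots $\Phi_+=\{\alpha_1,\alpha_2,\rho\}$; fundamental weights $\varpi_1,\varpi_2$ satisfy $(\varpi_i,\alpha_j)=\delta_{ij}$ (so $\rho=\varpi_1+\varpi_2$). For $\alpha\in\Phi$, $k\in\mathbb{Z}$, $H_{\alpha,k}=\{v:(\alpha,v)=k\}$ and $s_{\alpha,k}$ is the orthogonal reflection in $H_{\alpha,k}$. Alcoves are the connected components of $E\setminus\bigcup H_{\alpha,k}$; the fundamental alcove is $A_+=\{v:-1<(\alpha,v)<0 \ \forall \alpha\in\Phi_+\}$ (vertices $0,-\varpi_1,-\varpi_2$). $W$ is the group generated by $s_0=s_{\rho,-1}$, $s_1=s_{\alpha_1,0}$, $s_2=s_{\alpha_2,0}$; $(W,\{s_0,s_1,s_2\})$ is a Coxeter system of type $\widetilde{A}_2$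 with Bruhat order $\le$ and length $\ell$; indices of $s_i$ are read mod $3$. The map $w\mapsto wA_+$ is a bijection from $W$ to the set of alcoves, and $\operatorname{cen}(w)$ denotes the centroid of $wA_+$. $W_f=\langle s_1,s_2\rangle$. $C_+=\{v:(\alpha_1,v)>0,(\alpha_2,v)>0\}$ and $D=\{w\in W: wA_+\subset C_+\}$ (dominant elements); $s_0D=\{s_0w:w\in D\}$. For $k\ge1$, $\mathbf{x}_k=s_1s_2s_3\cdots s_k$ (indices mod 3). Symmetries. $\delta$ is the rotation of $E$ of order $3$ about the centroid of $A_+$ mapping the wall $H_{\rho,-1}$ to $H_{\alpha_1,0}$, $H_{\alpha_1,0}$ to $H_{\alpha_2,0}$, and $H_{\alpha_2,0}$ to $H_{\rho,-1}$; $\sigma$ is the orthogonal reflection of $E$ in the line $\mathbb{R}\rho$. For such an isometry $g$ and $w\in W$ put $g(w)=gwg^{-1}\in W$, so $g(wA_+)=g(w)A_+$; thus $\delta(s_i)=s_{i+1}$ and $\sigma$ fixes $s_0$ and swaps $s_1,s_2$. $G$ is the group of permutations of $W$ generated by $\delta,\sigma$ and $\iota:w\mapsto w^{-1}$. The polygon $\mathcal{C}_y$ (convex hull of the centers of the listed elements): if $y=\mathrm{id}$, $\mathcal{C}_y=\{\operatorname{cen}(\mathrm{id})\}$; if $y=s\in\{s_0,s_1,s_2\}$, $\mathcal{C}_y=\operatorname{Conv}\{\operatorname{cen}(\mathrm{id}),\operatorname{cen}(s)\}$; if $y\in\delta^i(D)$ ($i\in\{0,1,2\}$), $\mathcal{C}_y=\operatorname{Conv}\{\operatorname{cen}(wy):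 w\in\langle s_{i+1},s_{i+2}\rangle\}$; if $y\in\delta^i(s_0D)$, $\mathcal{C}_y=\operatorname{Conv}$ of the centers of $y, s_iy, s_{i+1}s_iy, s_{i+2}s_iy, s_is_{i+1}s_iy, s_is_{i+2}s_iy$; if $y=g(\mathbf{x}_k)$ with $g\in G$, $k\ge2$, $\mathcal{C}_y=\operatorname{Conv}$ of the centers of $g(\mathbf{x}_k),g(s_1\mathbf{x}_k),g(s_2s_1\mathbf{x}_k),g(s_1s_2s_1\mathbf{x}_k)$. The star $\mathcal{St}(x)$. For $c,p\in E$ let $T^{\triangleleft}(c;p)=\{v: M_1(v-c)\le M_1(p-c)\}$ with $M_1(u)=\max\{(\varpi_1,u),(-\varpi_2,u),(\varpi_2-\varpi_1,u)\}$, and $T^{\triangleright}(c;p)=\{v:M_2(v-c)\le M_2(p-c)\}$ with $M_2(u)=\max\{(\varpi_2,u),(-\varpi_1,u),(\varpi_1-\varpi_2,u)\}$ (closed equilateral triangles centered at $c$ with $p$ on the boundary). If $x\in D$: $\mathcal{St}(x)=T^{\triangleleft}(-\varpi_1;\operatorname{cen}(x))\cup T^{\triangleright}(-\varpi_2;\operatorname{cen}(x))$. If $x\in s_0D\cup\{\delta(\mathbf{x}_k):k\ge1\}$: $\mathcal{St}(x)=T^{\triangleleft}(0;\operatorname{cen}(x))\cup T^{\triangleright}(0;\operatorname{cen}(x))$. For general $x\neq\mathrm{id}$ there is $g\in\langle\delta,\sigma\rangle$ with $g(x)\in D\cup s_0D\cup\{\delta(\mathbf{x}_k):k\ge1\}$,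 and $\mathcal{St}(x)=g^{-1}(\mathcal{St}(g(x)))$ (with $g$ acting as an isometry of $E$).
   Formalization: In the star, the family δ(x_k) is replaced by δ^{-1}(x_k) (as written the claim fails for x = y = s_2); and for y = g(x_k), where the polygon depends on the choice of g in G, C_y is the union of the polygons over all such g and k. *)

(* Defs.v *)
From HB Require Import structures.
From Stdlib Require Import Relations.
From mathcomp Require Import all_boot all_order all_algebra.
From mathcomp Require Import ring lra.
From mathcomp Require Import all_classical all_reals all_analysis.

Set Implicit Arguments.
Unset Strict Implicit.
Unset Printing Implicit Defensive.

Import Order.TTheory GRing.Theory Num.Theory.
Import numFieldNormedType.Exports.

Local Open Scope classical_set_scope.
Local Open Scope ring_scope.

Definition dot (R : realType) (u v : 'rV[R]_2) : R :=
  \sum_(i < 2) u ord0 i * v ord0 i.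

(* The Euclidean plane is R^2 with its dot product; the simple roots are any
   two vectors with the Gram matrix of type A_2. *)
Record rootsA2 (R : realType) := RootsA2 {
  alpha1 : 'rV[R]_2;
  alpha2 : 'rV[R]_2;
  varpi1 : 'rV[R]_2;
  varpi2 : 'rV[R]_2;
  dot_alpha11 : dot alpha1 alpha1 = 2;
  dot_alpha22 : dot alpha2 alpha2 = 2;
  dot_alpha12 : dot alpha1 alpha2 = -1;
  dot_varpi11 : dot varpi1 alpha1 = 1;
  dot_varpi12 : dot varpi1 alpha2 = 0;
  dot_varpi21 : dot varpi2 alpha1 = 0;
  dot_varpi22 : dot varpi2 alpha2 = 1 }.

Section AffineA2.
Variables (R : realType) (P : rootsA2 R).

Local Notation E := 'rV[R]_2.
Local Notation a1 := (alpha1 P).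
Local Notation a2 := (alpha2 P).
Local Notation w1 := (varpi1 P).
Local Notation w2 := (varpi2 P).

Definition rho : E := a1 + a2.

Definition hyperplane (a : E) (k : R) : set E := [set v | dot a v = k].

Definition refl (a : E) (k : R) (v : E) : E :=
  v - (2 * (dot a v - k) / dot a a) *: a.

(* indices are read modulo 3 *)
Definition s (i : nat) : E -> E :=
  match (i %% 3)%N with
  | 0%N => refl rho (-1)
  | 1%N => refl a1 0
  | _ => refl a2 0
  end.

(* [prods [:: i_1; ...; i_n]] is s_{i_1} ... s_{i_n} *)
Definition prods (l : seq nat) : E -> E :=
  foldr (fun i f => s i \o f) id l.

(* The s_i being involutions, the words in the s_i form the group that they
   generate; likewise for [parabolic]. *)
Definition W : set (E -> E) := [set w | exists l, w = prods l].

Definition parabolic (i j : nat) : set (E -> E) :=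
  [set w | exists2 l : seq nat, {subset l <= [:: i; j]} & w = prods l].

(* the inverse of a bijection of E *)
Definition invf (f : E -> E) (v : E) : E := xget 0 [set u | f u = v].

Definition ell (w : E -> E) : nat :=
  xget 0%N [set n | (exists2 l, size l = n & w = prods l) /\
                    (forall l, w = prods l -> (n <= size l)%N)].

Definition reflection : set (E -> E) :=
  [set t | exists2 w, W w & exists i, t = w \o s i \o invf w].

Definition bruhat_step (u v : E -> E) : Prop :=
  [/\ W u, (exists2 t, reflection t & v = u \o t) & (ell u < ell v)%N].

Definition bruhat : (E -> E) -> (E -> E) -> Prop :=
  clos_refl_trans (E -> E) bruhat_step.

Definition bruhat_interval (x y : E -> E) : set (E -> E) :=
  [set z | [/\ W z, bruhat x z & bruhat z y]].

Definition Aplus : set E :=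
  [set v | [/\ -1 < dot a1 v < 0, -1 < dot a2 v < 0 & -1 < dot rho v < 0]].

Definition Cplus : set E := [set v | 0 < dot a1 v /\ 0 < dot a2 v].

(* w A_+ is the triangle with vertices w(0), w(-varpi_1), w(-varpi_2) *)
Definition cen (w : E -> E) : E := 3^-1 *: (w 0 + w (- w1) + w (- w2)).

Definition D : set (E -> E) := [set w | W w /\ w @` Aplus `<=` Cplus].

Definition s0D : set (E -> E) := [set s 0 \o w | w in D].

Definition xk (k : nat) : E -> E := prods (iota 1 k).

(* The affine map 0 |-> -varpi_1 |-> -varpi_2 |-> 0; the lemmas [delta_*] below
   identify it as the rotation of order 3 about the centroid of A_+ that
   permutes the walls as prescribed. *)
Definition delta (v : E) : E := - (dot rho v + 1) *: w1 + dot a1 v *: w2.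

(* orthogonal reflection in the line spanned by rho *)
Definition sigma (v : E) : E := (2 * dot rho v / dot rho rho) *: rho - v.

Definition conjf (g w : E -> E) : E -> E := g \o w \o invf g.

End AffineA2.

(* Closure of S and id under composition: the group generated by S as soon as
   the elements of S have finite order, which is how it is used. *)
Inductive generated (T : Type) (S : set (T -> T)) : set (T -> T) :=
| generated_id : generated S id
| generated_comp f g : S f -> generated S g -> generated S (f \o g).

Definition convex_hull (R : realType) (A : set 'rV[R]_2) : set 'rV[R]_2 :=
  smallest (@convex_set R 'rV[R]_2) A.

Section PolygonStar.
Variables (R : realType) (P : rootsA2 R).

Local Notation E := 'rV[R]_2.
Local Notation w1 := (varpi1 P).
Local Notation w2 := (varpi2 P).
Local Notation s := (s P).
Local Notation prods := (prods P).
Local Notation cen := (cen P).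
Local Notation D := (D P).
Local Notation s0D := (s0D P).
Local Notation xk := (xk P).
Local Notation delta := (delta P).
Local Notation sigma := (sigma P).

Definition isoms : set (E -> E) := generated [set delta; sigma].

Definition G : set ((E -> E) -> (E -> E)) :=
  generated [set conjf delta; conjf sigma; @invf R].

(* The five clauses concern disjoint sets of y.  In the last one, y may be
   g(x_k) for two elements g of G, only one of which lies in <delta, sigma>.
   The polygon attached to the other g is contained in the one attached to that
   g, so that the union over g is that polygon. *)
Inductive polygon (y : E -> E) : set E :=
| polygon_id v of
    y = id & v = cen id : polygon y v
| polygon_s i v of
    y = s i & convex_hull [set cen id; cen (s i)] v : polygon y v
| polygon_D i v of
    (i < 3)%N & [set iter i (conjf delta) w | w in D] y &
    convex_hull [set cen (w \o y) | w in parabolic P i.+1 i.+2] v : polygon y v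
| polygon_s0D i v of
    (i < 3)%N & [set iter i (conjf delta) w | w in s0D] y &
    convex_hull [set cen y;
              cen (prods [:: i] \o y);
              cen (prods [:: i.+1; i] \o y);
              cen (prods [:: i.+2; i] \o y);
              cen (prods [:: i; i.+1; i] \o y);
              cen (prods [:: i; i.+2; i] \o y)] v : polygon y v
| polygon_xk g k v of
    G g & (2 <= k)%N & y = g (xk k) &
    convex_hull [set cen (g (xk k));
              cen (g (prods [:: 1%N] \o xk k));
              cen (g (prods [:: 2%N; 1%N] \o xk k));
              cen (g (prods [:: 1%N; 2%N; 1%N] \o xk k))] v : polygon y v.

Definition M1 (u : E) : R :=
  Num.max (dot w1 u) (Num.max (dot (- w2) u) (dot (w2 - w1) u)).

Definition M2 (u : E) : R :=
  Num.max (dot w2 u) (Num.max (dot (- w1) u) (dot (w1 - w2) u)).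

Definition triangle_l (c p : E) : set E := [set v | M1 (v - c) <= M1 (p - c)].

Definition triangle_r (c p : E) : set E := [set v | M2 (v - c) <= M2 (p - c)].

(* delta^-1(x_k) = s_0 s_1 ... s_{k-1}: these alcoves start at s_0 A_+, beyond
   the wall of A_+ opposite to the centre 0 of the triangles.  (The words
   delta(x_k) = s_2 s_3 ... s_{k+1} start at s_2 A_+, which has 0 as a vertex.) *)
Definition strip : set (E -> E) :=
  [set x | exists2 k, (1 <= k)%N & x = conjf (invf delta) (xk k)].

Inductive star0 (x : E -> E) : set E :=
| star0_D v of
    D x & (triangle_l (- w1) (cen x) `|` triangle_r (- w2) (cen x)) v :
    star0 x v
| star0_s0D v of
    (s0D `|` strip) x & (triangle_l 0 (cen x) `|` triangle_r 0 (cen x)) v :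
    star0 x v.

(* g^-1(star0 (g(x))), for any isometry g that brings x into
   D, s_0 D or [strip]; [star0] is empty elsewhere *)
Definition star (x : E -> E) : set E :=
  [set v | exists2 g, isoms g & (g @^-1` star0 (conjf g x)) v].

End PolygonStar.

Section Sanity.
Variables (R : realType).

Local Notation E := 'rV[R]_2.

Lemma dotE (u v : E) :
  dot u v = u ord0 ord0 * v ord0 ord0 + u ord0 ord_max * v ord0 ord_max.
Proof.
rewrite /dot big_ord_recl big_ord1.
by have -> : lift ord0 ord0 = ord_max :> 'I_2 by apply/val_inj.
Qed.

Lemma dotC (u v : E) : dot u v = dot v u.
Proof. by rewrite !dotE; ring. Qed.

Lemma dotDr (u v w : E) : dot u (v + w) = dot u v + dot u w.
Proof. by rewrite !dotE !mxE; ring. Qed.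

Lemma dotNr (u v : E) : dot u (- v) = - dot u v.
Proof. by rewrite !dotE !mxE; ring. Qed.

Lemma dotZr (u v : E) k : dot u (k *: v) = k * dot u v.
Proof. by rewrite !dotE !mxE; ring. Qed.

Lemma dotDl (u v w : E) : dot (u + v) w = dot u w + dot v w.
Proof. by rewrite !(dotC _ w) dotDr. Qed.

Lemma row2P (u v : E) :
  u ord0 ord0 = v ord0 ord0 -> u ord0 ord_max = v ord0 ord_max -> u = v.
Proof.
move=> h0 h1; apply/rowP => -[[|[|//]] lti].
- by have -> : Ordinal lti = ord0 by apply/val_inj.
- by have -> : Ordinal lti = ord_max by apply/val_inj.
Qed.

Lemma rootsA2_inhabited : inhabited (rootsA2 R).
Proof.
pose mk (p q : R) : E := \row_(i < 2) (if i == ord0 then p else q).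
have dmk p q r t : dot (mk p q) (mk r t) = p * r + q * t.
  by rewrite dotE !mxE.
pose a := Num.sqrt 2 : R; pose b := Num.sqrt 6 : R.
have ha : a * a = 2 by rewrite -expr2 sqr_sqrtr.
have hb : b * b = 6 by rewrite -expr2 sqr_sqrtr.
constructor; apply: (@RootsA2 R (mk a 0) (mk (- a / 2) (b / 2))
  (mk (a / 2) (b / 6)) (mk 0 (b / 3))); rewrite dmk; nra.
Qed.

Variable P : rootsA2 R.

Local Notation a1 := (alpha1 P).
Local Notation a2 := (alpha2 P).
Local Notation w1 := (varpi1 P).
Local Notation w2 := (varpi2 P).

Lemma dot_inj (u v : E) : dot a1 u = dot a1 v -> dot a2 u = dot a2 v -> u = v.
Proof.
have := dot_alpha11 P; have := dot_alpha22 P; have := dot_alpha12 P.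
rewrite !dotE.
set p := a1 _ _; set q := a1 _ _; set r := a2 _ _; set t := a2 _ _.
set u0 := u _ _; set u1 := u _ _; set v0 := v _ _; set v1 := v _ _.
move=> h12 h22 h11 h1 h2.
have det : (p * t - q * r) ^+ 2 = 3.
  have -> : (p * t - q * r) ^+ 2 =
    (p * p + q * q) * (r * r + t * t) - (p * r + q * t) ^+ 2 by ring.
  by rewrite h12 h22 h11; ring.
have dn0 : p * t - q * r != 0.
  by rewrite -sqrf_eq0 det pnatr_eq0.
apply: row2P; rewrite -/u0 -/u1 -/v0 -/v1; apply: (mulfI dn0).
- have -> : (p * t - q * r) * u0 =
    t * (p * u0 + q * u1) - q * (r * u0 + t * u1) by ring.
  by rewrite h1 h2; ring.
- have -> : (p * t - q * r) * u1 =
    p * (r * u0 + t * u1) - r * (p * u0 + q * u1) by ring.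
  by rewrite h1 h2; ring.
Qed.

Let dotw := (dotC a1 w1, dotC a1 w2, dotC a2 w1, dotC a2 w2,
  dot_varpi11 P, dot_varpi12 P, dot_varpi21 P, dot_varpi22 P).

Lemma dot1_delta v : dot a1 (delta P v) = - (dot (rho P) v + 1).
Proof. by rewrite /delta dotDr !dotZr !dotw; ring. Qed.

Lemma dot2_delta v : dot a2 (delta P v) = dot a1 v.
Proof. by rewrite /delta dotDr !dotZr !dotw; ring. Qed.

Lemma dotr_delta v : dot (rho P) (delta P v) = - dot a2 v - 1.
Proof. by rewrite dotDl dot1_delta dot2_delta dotDl; ring. Qed.

Lemma delta_wall0 :
  delta P @^-1` hyperplane a1 0 = hyperplane (rho P) (-1).
Proof.
by apply/seteqP; split=> v; rewrite /hyperplane /= dot1_delta => h; lra.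
Qed.

Lemma delta_wall1 : delta P @^-1` hyperplane a2 0 = hyperplane a1 0.
Proof. by apply/seteqP; split=> v; rewrite /hyperplane /= dot2_delta. Qed.

Lemma delta_wall2 :
  delta P @^-1` hyperplane (rho P) (-1) = hyperplane a2 0.
Proof.
by apply/seteqP; split=> v; rewrite /hyperplane /= dotr_delta => h; lra.
Qed.

Lemma delta_order3 v : delta P (delta P (delta P v)) = v.
Proof.
apply: dot_inj; rewrite ?dot2_delta ?dot1_delta ?dotr_delta ?dot2_delta;
  by rewrite ?dot1_delta ?dotDl; ring.
Qed.

Lemma delta_cen : delta P (cen P id) = cen P id.
Proof.
by apply: dot_inj; rewrite ?dot1_delta ?dot2_delta /cen ?dotDl
  ?(dotZr, dotDr, dotNr) !dotw /=; rewrite !dotE !mxE; field.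
Qed.

Lemma varpi_expand v : v = dot a1 v *: w1 + dot a2 v *: w2.
Proof. by apply: dot_inj; rewrite dotDr !dotZr !dotw; ring. Qed.

Lemma varpi1E : w1 = (2 / 3) *: a1 + (1 / 3) *: a2.
Proof.
apply: dot_inj; rewrite dotDr !dotZr ?(dotC a2 a1) !dotw;
  by rewrite (dot_alpha11, dot_alpha22) dot_alpha12; field.
Qed.

Lemma varpi2E : w2 = (1 / 3) *: a1 + (2 / 3) *: a2.
Proof.
apply: dot_inj; rewrite dotDr !dotZr ?(dotC a2 a1) !dotw;
  by rewrite (dot_alpha11, dot_alpha22) dot_alpha12; field.
Qed.

Lemma delta_isometry u v :
  dot (delta P u - delta P v) (delta P u - delta P v) = dot (u - v) (u - v).
Proof.
have dotnE w : dot w w = (2 / 3) *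
    (dot a1 w ^+ 2 + dot a1 w * dot a2 w + dot a2 w ^+ 2).
  rewrite {2}(varpi_expand w) dotDr !dotZr varpi1E varpi2E !dotDr !dotZr.
  by rewrite !(dotC w); field.
have dotB a (p q : E) : dot a (p - q) = dot a p - dot a q.
  by rewrite dotDr dotNr.
by rewrite !dotnE !dotB !dot1_delta !dot2_delta !dotDl; field.
Qed.

End Sanity.

(* Main.v *)
(* Attach to every alcove the triple of integers counting the hyperplanes of each
   of the three directions that separate it from A_+, with signs.  Length is then
   the l^1 norm, <delta, sigma> permutes the coordinates, s_j is a left descent of
   A iff A_j >= 1, and the centre is determined by the differences A_i - A_j.
   The Bruhat order becomes the relation [hexle], six inequalities between
   differences: both relations satisfy A <= B iff min(A, s_j A) <= s_j B for a
   descent s_j of B (the lifting property), so they agree by induction on the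
   length.  For fixed B the six inequalities cut out a hexagon, which is the
   polygon of B: its vertices lie below B, and conversely a hexagon with sides in
   the three root directions is swept out by segments between its sides.  For
   fixed A, and A dominant, antidominant or in the strip, all but one inequality
   of each cycle are redundant, and the negations of the two remaining ones say
   that the centre is interior to one of the two triangles of the star. *)

From Stdlib Require Import Relations.
From mathcomp Require Import all_boot all_order all_algebra.
From mathcomp Require Import ring lra zify.
From mathcomp Require Import all_classical all_reals all_analysis.
Require Import Defs.

Import Order.TTheory GRing.Theory Num.Theory.
Import numFieldNormedType.Exports.

Set Implicit Arguments.
Unset Strict Implicit.
Unset Printing Implicit Defensive.

Local Open Scope classical_set_scope.
Local Open Scope ring_scope.

(** The recursion along descents determines a relation because every admissible triple other than
    the origin has a positive coordinate, hence a descent. For the Bruhat order the recursion comes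
    from the exchange property. For [hexle] it is a statement about nested maxima; it becomes linear
    once rotations and a swap have brought B into a position where the maxima can be evaluated.
    These normal positions, read off from signs, are also the cases in which polygons and stars are
    defined, so the same reduction serves throughout. Two obstacles remain. The polygon of g(x_k) is
    defined for every g in G, and inversion does not act on centres by an isometry; that clause is
    handled through the invariance of the Bruhat order under G. And the interior of a union of two
    triangles can exceed the union of their interiors; that this does not happen for the stars
    depends on the sizes of the triangles. *)

(* With k_1, k_2, k_r the integer parts of (alpha_1, -), (alpha_2, -), (rho, -)
   on an alcove, its coordinates are k_1 + 1, k_2 + 1 and -(k_r + 1).  They make
   <delta, sigma> act by permutations, A_+ is (0, 0, 0), and the triples that
   occur are those of sum 0 or 1. *)
Record alcove := Alcove { c1 : int; c2 : int; c3 : int }.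

Definition alcove0 := Alcove 0 0 0.

Definition valid (A : alcove) : bool :=
  (c1 A + c2 A + c3 A == 0) || (c1 A + c2 A + c3 A == 1).

(* Index 0 stands for the third coordinate: [arefl 0 k] is the reflection in
   H_{rho, -1-k}, while [arefl 1 k], [arefl 2 k] are those in H_{alpha_i, k}. *)
Definition arefl (i : nat) (k : int) (A : alcove) : alcove :=
  let: Alcove a b c := A in
  match (i %% 3)%N with
  | 0%N => Alcove (- b - k) (- a - k) (2 * k + 1 - c)
  | 1%N => Alcove (2 * k + 1 - a) (- c - k) (- b - k)
  | _ => Alcove (- c - k) (2 * k + 1 - b) (- a - k)
  end.

Definition acoord (i : nat) (A : alcove) : int :=
  match (i %% 3)%N with 0%N => c3 A | 1%N => c1 A | _ => c2 A end.

Definition alen (A : alcove) : nat := (`|c1 A| + `|c2 A| + `|c3 A|)%N.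

Definition astep (A B : alcove) : Prop :=
  (exists i k, B = arefl i k A) /\ (alen A < alen B)%N.

Definition abruhat : alcove -> alcove -> Prop := clos_refl_trans alcove astep.

(** Origin of the shifts: a simple reflection exchanges two neighbours of a cycle and fixes the
    third entry; the exchange subtracts 1 in the direction p, q, r, p and adds 1 in the other. A
    bound on one entry thus reaches the next one lowered by 1 and the one after that lowered by
    2. *)
Definition cyc_le (p q r p' q' r' : int) : Prop :=
  p <= Num.max p' (Num.max (r' - 1) (q' - 2)) /\
  q <= Num.max q' (Num.max (p' - 1) (r' - 2)) /\
  r <= Num.max r' (Num.max (q' - 1) (p' - 2)).

(* The six differences of coordinates are, up to constants, the inner products of
   the centre with the six minuscule weights; they form two cycles, namely
   13 -> 21 -> 32 and 23 -> 12 -> 31.  The right-hand sides are the maxima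
   over the polygon of B. *)
Definition hexle (A B : alcove) : Prop :=
  cyc_le (c1 A - c3 A) (c2 A - c1 A) (c3 A - c2 A)
         (c1 B - c3 B) (c2 B - c1 B) (c3 B - c2 B) /\
  cyc_le (c2 A - c3 A) (c1 A - c2 A) (c3 A - c1 A)
         (c2 B - c3 B) (c1 B - c2 B) (c3 B - c1 B).

(** * Reflections and length on integer triples *)

Lemma arefl_mod i k A : arefl (i %% 3) k A = arefl i k A.
Proof. by rewrite /arefl modn_mod. Qed.

Lemma acoord_mod i A : acoord (i %% 3) A = acoord i A.
Proof. by rewrite /acoord modn_mod. Qed.

Lemma mod3P (Q : nat -> Prop) :
  (forall i, Q (i %% 3)%N -> Q i) -> Q 0%N -> Q 1%N -> Q 2%N -> forall i, Q i.
Proof.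
move=> hQ h0 h1 h2 i; apply: hQ.
by have := ltn_pmod i (isT : (0 < 3)%N); case: (i %% 3)%N => [|[|[|]]].
Qed.

Lemma alcoveP A B : c1 A = c1 B -> c2 A = c2 B -> c3 A = c3 B -> A = B.
Proof. by case: A B => [a b c] [a' b' c'] /= -> -> ->. Qed.

Lemma arefl_valid i k A : valid A -> valid (arefl i k A).
Proof.
case: A => a b c; elim/mod3P: i => [i|||]; first by rewrite arefl_mod.
all: rewrite /valid /=; lia.
Qed.

Lemma areflK i k A : arefl i k (arefl i k A) = A.
Proof.
case: A => a b c; elim/mod3P: i => [i|||]; first by rewrite !arefl_mod.
all: apply: alcoveP => /=; lia.
Qed.

Lemma arefl_conj i k j :
  exists i' k', forall A, arefl j 0 (arefl i k (arefl j 0 A)) = arefl i' k' A.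
Proof.
elim/mod3P: i => [i|||].
  by case=> i' [k' h]; exists i', k' => A; rewrite -h arefl_mod.
all: elim/mod3P: j => [j|||]; try by
  case=> i' [k' h]; exists i', k' => A; rewrite -h !arefl_mod.
(* For i = j the simple reflection keeps the direction and negates k; otherwise the root goes to the
   third direction and k to -1-k. *)
all: [> exists 0%N, (- k) | exists 2%N, (- 1 - k) | exists 1%N, (- 1 - k)
      | exists 2%N, (- 1 - k) | exists 1%N, (- k) | exists 0%N, (- 1 - k)
      | exists 1%N, (- 1 - k) | exists 0%N, (- 1 - k) | exists 2%N, (- k)];
  case=> a b c; apply: alcoveP => /=; lia.
Qed.

Lemma alen_arefl j A : valid A ->
  if 1 <= acoord j A then alen A = (alen (arefl j 0 A)).+1
  else alen (arefl j 0 A) = (alen A).+1.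
Proof.
case: A => a b c; elim/mod3P: j => [i|||]; first by rewrite acoord_mod arefl_mod.
all: rewrite /alen /acoord /valid /=; case: ifP; lia.
Qed.

Lemma acoord_arefl j A : acoord j (arefl j 0 A) = 1 - acoord j A.
Proof.
case: A => a b c; elim/mod3P: j => [i|||]; first by rewrite !acoord_mod arefl_mod.
all: rewrite /acoord /=; lia.
Qed.

(* The exchange property: a reflection that raises the length by exactly one
   cannot create a descent at j, unless it is s_j. *)
Lemma alen_lift j i k A (C := arefl i k A) : valid A ->
  acoord j A <= 0 -> 1 <= acoord j C -> (alen A < alen C)%N ->
  C = arefl j 0 A \/ (alen (arefl j 0 A) < alen (arefl j 0 C))%N.
Proof.
rewrite {}/C; case: A => a b c hA hj hC hl.
(* A reflection exchanges the sums 0 and 1, so it changes the length by an odd number: the gap is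
   one or at least three. Since s_j lengthens A by one and shortens C by one, a gap of at least
   three leaves s_j A shorter than s_j C. *)
suff [hk|hk] : arefl i k (Alcove a b c) = arefl j 0 (Alcove a b c) \/
   ((alen (Alcove a b c)).+2 < alen (arefl i k (Alcove a b c)))%N.
- by left.
  right; have := alen_arefl j hA; have := alen_arefl j (arefl_valid i k hA).
  have -> : (1 <= acoord j (Alcove a b c)) = false by lia.
  rewrite hC; lia.
move: hA hj hC hl.
elim/mod3P: j => [j|||]; first by rewrite !acoord_mod !arefl_mod.
all: elim/mod3P: i => [i|||]; first by rewrite !arefl_mod.
all: rewrite /valid /acoord /alen /= => hA hj hC hl.
all: case: (k =P 0) => hk; first (try by left; apply: alcoveP => /=; lia).
all: right; lia.
Qed.

(** * The lifting property of the Bruhat order *)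

Definition adown j A := if 1 <= acoord j A then arefl j 0 A else A.

Definition aup j A := if 1 <= acoord j A then A else arefl j 0 A.

Lemma astep_valid A B : valid A -> astep A B -> valid B.
Proof. by move=> hA [[i [k ->]] _]; apply: arefl_valid. Qed.

Lemma abruhat_valid A B : abruhat A B -> valid A -> valid B.
Proof. by elim=> // {}A {}B; [move=> h /astep_valid;
  apply | move=> C _ h1 _ h2 /h1]. Qed.

Lemma abruhat_alen A B : abruhat A B -> (alen A <= alen B)%N.
Proof.
by elim=> // {}A {}B; [case=> _ /ltnW | move=> C _ h1 _; apply: leq_trans].
Qed.

Lemma abruhat_trans A B C : abruhat A B -> abruhat B C -> abruhat A C.
Proof. exact: rt_trans. Qed.

Lemma abruhat_step A B : astep A B -> abruhat A B.
Proof. exact: rt_step. Qed.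

Lemma astep_down j A : valid A -> 1 <= acoord j A -> astep (arefl j 0 A) A.
Proof.
move=> hA hj; split; first by exists j, 0; rewrite areflK.
by have := alen_arefl j hA; rewrite hj => ->.
Qed.

Lemma astep_up j A : valid A -> (1 <= acoord j A) = false ->
  astep A (arefl j 0 A).
Proof.
move=> hA hj; split; first by exists j, 0.
by have := alen_arefl j hA; rewrite hj => ->.
Qed.

Lemma astep_arefl j A C : valid A -> astep A C ->
  (1 <= acoord j A) = (1 <= acoord j C) -> astep (arefl j 0 A) (arefl j 0 C).
Proof.
move=> hA [[i [k hC]] hl] hj; split.
  have [i' [k' h]] := arefl_conj i k j.
  by exists i', k'; rewrite -h areflK hC.
have := alen_arefl j hA; have hC' : valid C by rewrite hC arefl_valid.
have := alen_arefl j hC'; rewrite -hj; case: ifP; lia.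
Qed.

(** Conjugation by s_j settles the cases where j is a descent of both or of neither, and
    transitivity the case where it is one of A only. If it is one of C only, the exchange property
    gives C = s_j A or the chain A < s_j A < s_j C < C. *)
Lemma astep_lift j A C : valid A -> astep A C ->
  abruhat (adown j A) (adown j C) /\ abruhat (aup j A) (aup j C).
Proof.
move=> hA hAC; have hC := astep_valid hA hAC.
have hAC' := abruhat_step hAC.
have hstep := astep_arefl hA hAC; rewrite /adown /aup.
have hup := @astep_up j _ hA; have hdn := @astep_down j _ hA.
have hupC := @astep_up j _ hC; have hdnC := @astep_down j _ hC.
case hjA : (1 <= acoord j A) hup hdn; case hjC : (1 <= acoord j C) hupC hdnC.
- by move=> *; split=> //; apply/abruhat_step/hstep; rewrite hjA hjC.
- move=> h1 _ _ h2; split.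
  + exact/(abruhat_trans (abruhat_step (h2 isT))).
  + exact/(abruhat_trans hAC')/abruhat_step/h1.
- move=> _ h1 h2 _.
  case: hAC => [[i [k eC]] hl].
  have := @alen_lift j i k A hA; rewrite -eC => -[|||->|h3] //.
  + by move: hjA; lia.
  + by rewrite areflK; split; apply: rt_refl.
  have h4 : astep (arefl j 0 A) (arefl j 0 C).
    split=> //; have [i' [k' h]] := arefl_conj i k j.
    by exists i', k'; rewrite -h areflK eC.
  split; first exact/(abruhat_trans (abruhat_step (h2 erefl)))/abruhat_step.
  exact/(abruhat_trans (abruhat_step h4))/abruhat_step/h1.
- by move=> *; split=> //; apply/abruhat_step/hstep; rewrite hjA hjC.
Qed.

Lemma abruhat_lift j A C : valid A -> abruhat A C ->
  abruhat (adown j A) (adown j C) /\ abruhat (aup j A) (aup j C).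
Proof.
move=> hA hAC; elim: hAC hA => [B C' h hB|B _|B C' C'' h1 IH1 h2 IH2 hB].
- exact: astep_lift.
- by split; apply: rt_refl.
have [d1 u1] := IH1 hB; have [d2 u2] := IH2 (abruhat_valid h1 hB).
by split; [apply: abruhat_trans d2 | apply: abruhat_trans u2].
Qed.

(** * The hexagon inequalities and their symmetries *)

Lemma cyc_le_rot p q r p' q' r' :
  cyc_le p q r p' q' r' <-> cyc_le q r p q' r' p'.
Proof. by rewrite /cyc_le; lia. Qed.

(** A dominating entry p' supplies all three maxima as it is carried around the cycle. In
    [cyc_le_flat] no entry dominates: p' and q' nearly agree, each bounds its own entry, and q' also
    bounds the third. *)
Lemma cyc_le_peak p q r p' q' r' : q' < p' -> r' + 2 <= p' ->
  cyc_le p q r p' q' r' <-> p <= p' /\ q <= p' - 1 /\ r <= p' - 2.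
Proof. by rewrite /cyc_le; lia. Qed.

Lemma cyc_le_flat p q r p' q' r' : r' < q' -> p' <= q' + 1 -> q' <= p' + 1 ->
  cyc_le p q r p' q' r' <-> p <= p' /\ q <= q' /\ r <= q' - 1.
Proof. by rewrite /cyc_le; lia. Qed.

Definition dominant (A : alcove) : bool := [&& 1 <= c1 A, 1 <= c2 A & c3 A <= -1].

Definition antidominant (A : alcove) : bool :=
  [&& c1 A <= -1, c2 A <= -1 & 1 <= c3 A].

(** With validity these are the alcoves of delta^-1(x_k) for k >= 2. The case k = 1, where the
    second coordinate is 0, is the alcove of s_0 and is kept apart because its polygon is a
    segment. *)
Definition in_strip (A : alcove) : bool :=
  [&& c1 A == 0, c2 A <= -1 & 1 <= c3 A].

Lemma hexle_dominant A B : valid B -> dominant B ->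
  hexle A B <->
  (c1 A - c3 A <= c1 B - c3 B /\ c2 A - c1 A <= c1 B - c3 B - 1 /\
   c3 A - c2 A <= c1 B - c3 B - 2) /\
  (c2 A - c3 A <= c2 B - c3 B /\ c1 A - c2 A <= c2 B - c3 B - 1 /\
   c3 A - c1 A <= c2 B - c3 B - 2).
Proof.
move=> hB dB; rewrite /hexle !cyc_le_peak //.
all: by move: hB dB; rewrite /valid /dominant; lia.
Qed.

Lemma hexle_antidominant A B : valid B -> antidominant B ->
  hexle A B <->
  (c3 A - c2 A <= c3 B - c2 B /\ c1 A - c3 A <= c3 B - c2 B - 1 /\
   c2 A - c1 A <= c3 B - c2 B - 2) /\
  (c3 A - c1 A <= c3 B - c1 B /\ c2 A - c3 A <= c3 B - c1 B - 1 /\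
   c1 A - c2 A <= c3 B - c1 B - 2).
Proof.
move=> hB dB; rewrite /hexle.
rewrite cyc_le_rot (cyc_le_rot (c2 A - c1 A)) cyc_le_peak.
  rewrite cyc_le_rot (cyc_le_rot (c1 A - c2 A)) cyc_le_peak //.
all: by move: hB dB; rewrite /valid /antidominant; lia.
Qed.

Lemma hexle_strip A B : valid B -> in_strip B ->
  hexle A B <->
  (c3 A - c2 A <= c3 B - c2 B /\ c1 A - c3 A <= c3 B - c2 B - 1 /\
   c2 A - c1 A <= c3 B - c2 B - 2) /\
  (c3 A - c1 A <= c3 B /\ c2 A - c3 A <= c3 B - 1 /\ c1 A - c2 A <= - c2 B).
Proof.
move=> hB dB; have hB1 : c1 B = 0 by move: dB; rewrite /in_strip; lia.
rewrite /hexle cyc_le_rot (cyc_le_rot (c2 A - c1 A)) cyc_le_peak.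
  rewrite cyc_le_rot cyc_le_flat.
all: by move: hB dB; rewrite /valid /in_strip; lia.
Qed.

Definition arot (A : alcove) := let: Alcove a b c := A in Alcove c a b.

Definition aswap (A : alcove) := let: Alcove a b c := A in Alcove b a c.

Lemma hexle_rot A B : hexle (arot A) (arot B) <-> hexle A B.
Proof.
case: A B => [a b c] [a' b' c']; rewrite /hexle /=.
by rewrite (cyc_le_rot (c - b)) (cyc_le_rot (a - b)) (cyc_le_rot (c - a)).
Qed.

Lemma hexle_swap A B : hexle (aswap A) (aswap B) <-> hexle A B.
Proof.
by case: A B => [a b c] [a' b' c']; rewrite /hexle /=; split=> -[].
Qed.


Lemma hexle_simple A : valid A ->
  hexle A (Alcove 0 0 1) <-> A = alcove0 \/ A = Alcove 0 0 1.
Proof.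
case: A => a b c; rewrite /valid /hexle /cyc_le /= => hA; split=> [h|[|] [-> ->
  ->]]; last by [].
  suff: (a == 0) && (b == 0) && ((c == 0) || (c == 1)).
    by move=> /andP[/andP[/eqP-> /eqP->] /orP[] /eqP->]; [left|right].
  lia.
by [].
Qed.

(** One position for each clause of [polygon]; the last disjunct holds the alcoves of id and s_0. *)
Definition standard (A : alcove) : bool :=
  [|| dominant A, antidominant A, in_strip A |
      [&& c1 A == 0, c2 A == 0 & (c3 A == 0) || (c3 A == 1)]].

Lemma valid_rot A : valid (arot A) = valid A.
Proof. by case: A => a b c; rewrite /valid /=; congr (_ || _); lia. Qed.

Lemma valid_swap A : valid (aswap A) = valid A.
Proof. by case: A => a b c; rewrite /valid /=; congr (_ || _); lia. Qed.

(** A sum of 0 or 1 leaves few sign patterns: both signs without a zero, one zero between a positive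
    and a negative entry, or two zeros and an entry 0 or 1. At most two rotations put the
    exceptional coordinate in place; the swap is needed for the strip, whose pattern it does not
    preserve. *)
Lemma alcove_sym_ind (Q : alcove -> Prop) :
  (forall A, valid A -> Q (arot A) -> Q A) ->
  (forall A, valid A -> Q (aswap A) -> Q A) ->
  (forall A, valid A -> standard A -> Q A) -> forall A, valid A -> Q A.
Proof.
move=> hr hs hQ A hA.
have base B : valid B -> standard B || standard (aswap B) -> Q B.
  move=> hB /orP[/(hQ _ hB) //|h]; apply: hs => //; apply: hQ => //.
  by rewrite valid_swap.
have [h|hn1] := boolP (standard A || standard (aswap A)); first exact: base.
apply: (hr) => //.
have [h|hn2] := boolP (standard (arot A) || standard (aswap (arot A))).
  by apply: base; rewrite ?valid_rot.
apply: (hr); rewrite ?valid_rot //; apply: base; rewrite ?valid_rot //.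
case: A hA hn1 hn2 => a b c; rewrite /valid /standard /dominant /antidominant.
rewrite /in_strip /= => hA.
have sgn (x : int) : [\/ [/\ 1 <= x, (x <= -1) = false & (x == 0) = false],
    [/\ (1 <= x) = false, x <= -1 & (x == 0) = false] |
    [/\ (1 <= x) = false, (x <= -1) = false & x == 0]].
  have [h|h|h] := ltgtP x 0; [apply: Or32|apply: Or31|apply: Or33]; split; lia.
by case: (sgn a) => -[a1 a2 a3]; case: (sgn b) => -[b1 b2 b3];
  case: (sgn c) => -[d1 d2 d3]; rewrite ?(a1, a2, a3, b1, b2, b3, d1, d2, d3) //=; lia.
Qed.

Lemma eq_arefl i j k A : i = j %[mod 3] -> arefl i k A = arefl j k A.
Proof. by rewrite /arefl => ->. Qed.

Lemma eq_acoord i j A : i = j %[mod 3] -> acoord i A = acoord j A.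
Proof. by rewrite /acoord => ->. Qed.

Lemma arefl_rot i k A : arefl i.+1 k (arot A) = arot (arefl i k A).
Proof.
case: A => a b c; elim/mod3P: i => [i|||] //.
by rewrite (arefl_mod i) => <-; apply: eq_arefl;
  rewrite -(addn1 i) -(addn1 (i %% 3)) modnDml.
Qed.

(** Modulo 3, doubling an index fixes 0 and exchanges 1 and 2, as sigma does. *)
Lemma arefl_swap i k A : arefl (2 * i) k (aswap A) = aswap (arefl i k A).
Proof.
case: A => a b c; elim/mod3P: i => [i|||] //.
by rewrite (arefl_mod i) => <-; apply: eq_arefl; rewrite modnMmr.
Qed.

Lemma acoord_rot i A : acoord i.+1 (arot A) = acoord i A.
Proof.
case: A => a b c; elim/mod3P: i => [i|||] //.
by rewrite (acoord_mod i) => <-; apply: eq_acoord;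
  rewrite -(addn1 i) -(addn1 (i %% 3)) modnDml.
Qed.

Lemma hexle_up1 A B : valid A -> valid B -> 1 <= c1 B ->
  hexle (adown 1 A) (arefl 1 0 B) -> hexle A B.
Proof.
case: A B => [a b c] [a' b' c']; rewrite /valid /adown /acoord /= => hA hB ha'.
rewrite /hexle /cyc_le; case: ifP => ha /=; rewrite !le_max.
all: move=> [[h1 [h2 h3]] [h4 [h5 h6]]]; repeat apply: conj.
(* Since s_1 permutes the six differences up to shifts, each of the six goals follows from a single
   hypothesis. *)
all: first [clear h2 h3 h4 h5 h6; lia | clear h1 h3 h4 h5 h6; lia
           | clear h1 h2 h4 h5 h6; lia | clear h1 h2 h3 h5 h6; lia
           | clear h1 h2 h3 h4 h6; lia | clear h1 h2 h3 h4 h5; lia].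
Qed.

(** In this direction the maxima of B stand in the hypothesis. The symmetries move B to a position
    where the hypothesis is six plain inequalities; the goal keeps its maxima. *)
Lemma hexle_down1 A B : valid A -> valid B -> 1 <= c1 B -> hexle A B ->
  hexle (adown 1 A) (arefl 1 0 B).
Proof.
move=> hA hB hB1.
(* Given a positive first coordinate, these say that B or its rotation is dominant, that its second
   rotation is antidominant, or that the second rotation lies in the strip, after a swap in the last
   case; the triple (1, 0, 0) is a rotated s_0 and is treated apart. *)
have : [\/ 1 <= c2 B, 1 <= c3 B, (c2 B <= -1) && (c3 B <= -1) | 
   (c3 B <= 0) && (c2 B == 0) \/ (c2 B <= -1) && (c3 B == 0)].
  move: hB; rewrite /valid => hB.
  case h2: (1 <= c2 B); first exact: Or41.
  case h3: (1 <= c3 B); first exact: Or42.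
  case h4: ((c2 B <= -1) && (c3 B <= -1)); first exact: Or43.
  apply: Or44; case h5: (c2 B == 0); [left|right]; lia.
case: A B hA hB hB1 => [a b c] [a' b' c']; rewrite /valid /= => hA hB hB1.
case=> [h|h|h|[h|h]].
- have vB : valid (Alcove a' b' c') by rewrite /valid /=; lia.
  have dB : dominant (Alcove a' b' c') by rewrite /dominant /=; lia.
  move=> /(hexle_dominant _ vB dB).
  rewrite /adown /acoord /hexle /cyc_le /=; case: ifP => ha /=; rewrite !le_max;
    move=> -[[? [? ?]] [? [? ?]]]; repeat apply: conj; lia.
- have vB : valid (arot (Alcove a' b' c')) by rewrite /valid /=; lia.
  have dB : dominant (arot (Alcove a' b' c')) by rewrite /dominant /=; lia.
  move=> /(iffRL (hexle_rot _ _))/(hexle_dominant _ vB dB).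
  rewrite /adown /acoord /hexle /cyc_le /=; case: ifP => ha /=; rewrite !le_max;
    move=> -[[? [? ?]] [? [? ?]]]; repeat apply: conj; lia.
- have vB : valid (arot (arot (Alcove a' b' c'))) by rewrite /valid /=; lia.
  have dB : antidominant (arot (arot (Alcove a' b' c'))) by rewrite /antidominant
    /=; lia.
  move=> /(iffRL (hexle_rot _ _))/(iffRL (hexle_rot _ _))/(hexle_antidominant _ vB dB).
  rewrite /adown /acoord /hexle /cyc_le /=; case: ifP => ha /=; rewrite !le_max;
    move=> -[[? [? ?]] [? [? ?]]]; repeat apply: conj; lia.
- have [hc|hc] := eqVneq c' 0.
    move=> /(iffRL (hexle_rot _ _))/(iffRL (hexle_rot _ _)).
    have -> : arot (arot (Alcove a' b' c')) = Alcove 0 0 1.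
      by apply: alcoveP => /=; lia.
    have vA : valid (arot (arot (Alcove a b c))) by rewrite /valid /=; lia.
    have [-> -> ->] : [/\ a' = 1, b' = 0 & c' = 0] by split; lia.
    by move/(hexle_simple vA) => [] [-> -> ->].
  have vB : valid (arot (arot (Alcove a' b' c'))) by rewrite /valid /=; lia.
  have dB : in_strip (arot (arot (Alcove a' b' c'))) by rewrite /in_strip /=; lia.
  move=> /(iffRL (hexle_rot _ _))/(iffRL (hexle_rot _ _))/(hexle_strip _ vB dB).
  rewrite /adown /acoord /hexle /cyc_le /=; case: ifP => ha /=; rewrite !le_max;
    move=> -[[? [? ?]] [? [? ?]]]; repeat apply: conj; lia.
- have vB : valid (aswap (arot (arot (Alcove a' b' c')))) by rewrite /valid /=; lia.
  have dB : in_strip (aswap (arot (arot (Alcove a' b' c')))) by rewrite /in_strip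
    /=; lia.
  move=> /(iffRL (hexle_rot _ _))/(iffRL (hexle_rot _ _))/(iffRL (hexle_swap _
    _))/(hexle_strip _ vB dB).
  rewrite /adown /acoord /hexle /cyc_le /=; case: ifP => ha /=; rewrite !le_max;
    move=> -[[? [? ?]] [? [? ?]]]; repeat apply: conj; lia.
Qed.

Lemma hexle_down j A B : valid A -> valid B -> 1 <= acoord j B ->
  hexle A B <-> hexle (adown j A) (arefl j 0 B).
Proof.
have base X Y : valid X -> valid Y -> 1 <= acoord 1 Y ->
    hexle X Y <-> hexle (adown 1 X) (arefl 1 0 Y).
  by move=> hX hY h; split; [apply: hexle_down1 | apply: hexle_up1].
have rot i X : adown i.+1 (arot X) = arot (adown i X).
  by rewrite /adown acoord_rot arefl_rot; case: ifP.
move=> hA hB; elim/mod3P: j => [j|||]; first by rewrite /adown !acoord_mod !arefl_mod.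
- rewrite -acoord_rot => h; rewrite -(hexle_rot A) -(hexle_rot (adown _ _)).
  by rewrite -rot -arefl_rot; apply: base; rewrite ?valid_rot.
- exact: base.
- rewrite -acoord_rot -acoord_rot => h.
  rewrite -(hexle_rot A) -(hexle_rot (adown _ _)) -(hexle_rot (arot A)).
  rewrite -(hexle_rot (arot (adown _ _))) -!rot -!arefl_rot.
  by apply: base; rewrite ?valid_rot.
Qed.

Lemma valid_descent A : valid A -> A <> alcove0 -> exists j, 1 <= acoord j A.
Proof.
case: A => a b c; rewrite /valid /= => hA hn.
case h1: (1 <= a); first by exists 1%N; rewrite /acoord.
case h2: (1 <= b); first by exists 2%N; rewrite /acoord.
case h3: (1 <= c); first by exists 0%N; rewrite /acoord.
by case: hn; apply: alcoveP => /=; lia.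
Qed.

Lemma alen_eq0 A : alen A = 0%N -> A = alcove0.
Proof. by case: A => a b c; rewrite /alen /= => h; apply: alcoveP => /=; lia. Qed.

Theorem abruhatP A B : valid A -> valid B -> abruhat A B <-> hexle A B.
Proof.
move=> hA hB; have [n] := ubnP (alen B).
elim: n A B hA hB => // n IHn A B hA hB hn.
have [hB0|hB0] := pselect (B = alcove0).
  rewrite {B hB hn}hB0; split=> [/abruhat_alen h|h].
    rewrite (@alen_eq0 A); last by move: h; rewrite /alen /=; lia.
    by rewrite /hexle /cyc_le /=;lia.
  suff -> : A = alcove0 by apply: rt_refl.
  move: hA h; case: A => a b c; rewrite /valid /hexle /cyc_le /= => hA h.
  by apply: alcoveP => /=; lia.
have [j hj] := valid_descent hB hB0.
have := alen_arefl j hB; rewrite hj => hl.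
have hdA : valid (adown j A) by rewrite /adown; case: ifP => // _; apply: arefl_valid.
have hdB := arefl_valid j 0 hB.
rewrite (hexle_down hA hB hj) -(IHn _ _ hdA hdB); last by lia.
split=> [/(abruhat_lift j hA) []|]; first by rewrite {2}/adown hj.
(* The converse uses the upper half of the lifting property: s_j B lifts back to B and min(A, s_j A)
   to max(A, s_j A), which lies above A. *)
move=> /(abruhat_lift j hdA) [_].
have -> : aup j (arefl j 0 B) = B.
  rewrite /aup acoord_arefl areflK; case: ifP => //; lia.
have -> : aup j (adown j A) = aup j A.
  rewrite /aup /adown; case h: (1 <= acoord j A); rewrite ?h //.
  by rewrite acoord_arefl areflK; case: ifP => //; lia.
apply: abruhat_trans; rewrite /aup; case: ifP => h; first exact: rt_refl.
exact/abruhat_step/astep_up.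
Qed.

(** * Elements of W as alcoves *)

Section Alcoves.
Variables (R : realType) (P : rootsA2 R).

Local Notation E := 'rV[R]_2.
Local Notation a1 := (alpha1 P).
Local Notation a2 := (alpha2 P).
Local Notation w1 := (varpi1 P).
Local Notation w2 := (varpi2 P).
Local Notation s := (s P).
Local Notation prods := (prods P).

Let dots := (dot_alpha11 P, dot_alpha22 P, dot_alpha12 P, dotC a2 a1,
  dotC a1 w1, dotC a1 w2, dotC a2 w1, dotC a2 w2,
  dot_varpi11 P, dot_varpi12 P, dot_varpi21 P, dot_varpi22 P).

Definition srefl (i : nat) (k : int) : E -> E :=
  match (i %% 3)%N with
  | 0%N => refl (rho P) (- 1 - k%:~R)
  | 1%N => refl a1 k%:~R
  | _ => refl a2 k%:~R
  end.

Lemma s_srefl i : s i = srefl i 0.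
Proof. by rewrite /srefl /s; case: (i %% 3)%N => [|[|?]] //; rewrite subr0. Qed.

Lemma dotBr (u v w : E) : dot u (v - w) = dot u v - dot u w.
Proof. by rewrite dotDr dotNr. Qed.

Lemma dot_rho v : dot (rho P) v = dot a1 v + dot a2 v.
Proof. by rewrite dotDl. Qed.

Lemma dot0r (u : E) : dot u 0 = 0.
Proof. by rewrite -(scale0r 0) dotZr mul0r. Qed.

Definition d1_srefl (i : nat) (k : int) (x y : R) : R :=
  match (i %% 3)%N with
  | 0%N => - 1 - k%:~R - y
  | 1%N => 2 * k%:~R - x
  | _ => x + y - k%:~R
  end.

Definition d2_srefl (i : nat) (k : int) (x y : R) : R :=
  match (i %% 3)%N with
  | 0%N => - 1 - k%:~R - x
  | 1%N => x + y - k%:~R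
  | _ => 2 * k%:~R - y
  end.

Lemma dot1_srefl i k v :
  dot a1 (srefl i k v) = d1_srefl i k (dot a1 v) (dot a2 v).
Proof.
rewrite /srefl /d1_srefl; case: (i %% 3)%N => [|[|?]]; rewrite /refl dotBr dotZr.
- by rewrite !dot_rho /rho !dotDr !dots; field.
- by rewrite !dots; field.
- by rewrite !dots; field.
Qed.

Lemma dot2_srefl i k v :
  dot a2 (srefl i k v) = d2_srefl i k (dot a1 v) (dot a2 v).
Proof.
rewrite /srefl /d2_srefl; case: (i %% 3)%N => [|[|?]]; rewrite /refl dotBr dotZr.
- by rewrite !dot_rho /rho !dotDr !dots; field.
- by rewrite !dots; field.
- by rewrite !dots; field.
Qed.

Lemma sreflK i k v : srefl i k (srefl i k v) = v.
Proof.
apply: (@dot_inj _ P); rewrite !(dot1_srefl, dot2_srefl) /d1_srefl /d2_srefl.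
all: by case: (i %% 3)%N => [|[|?]]; ring.
Qed.

Lemma s_srefl_same i k v : s i (srefl i k v) = srefl i (- k) (s i v).
Proof.
rewrite s_srefl; apply: (@dot_inj _ P);
  rewrite !(dot1_srefl, dot2_srefl) /d1_srefl /d2_srefl intrN;
  by case: (i %% 3)%N => [|[|?]]; ring.
Qed.

Lemma s_srefl_next i k v :
  s i.+1 (srefl i k v) = srefl i.+2 (- 1 - k) (s i.+1 v).
Proof.
rewrite s_srefl; apply: (@dot_inj _ P);
  rewrite !(dot1_srefl, dot2_srefl) /d1_srefl /d2_srefl intrB;
  rewrite -(addn2 i) -(addn1 i) -(modnDml i 1) -(modnDml i 2);
  have := ltn_pmod i (isT : (0 < 3)%N);
  by case: (i %% 3)%N => [|[|[|]]] //= _; ring.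
Qed.

Lemma s_srefl_prev i k v :
  s i.+2 (srefl i k v) = srefl i.+1 (- 1 - k) (s i.+2 v).
Proof.
rewrite s_srefl; apply: (@dot_inj _ P);
  rewrite !(dot1_srefl, dot2_srefl) /d1_srefl /d2_srefl intrB;
  rewrite -(addn2 i) -(addn1 i) -(modnDml i 1) -(modnDml i 2);
  have := ltn_pmod i (isT : (0 < 3)%N);
  by case: (i %% 3)%N => [|[|[|]]] //= _; ring.
Qed.

Lemma eq_srefl i j k : i = j %[mod 3] -> srefl i k = srefl j k.
Proof. by rewrite /srefl => ->. Qed.

Lemma s_srefl_commute i k j : exists i' k',
  forall v, s j (srefl i k v) = srefl i' k' (s j v).
Proof.
have h3 : [\/ j = i %[mod 3], j = i.+1 %[mod 3] | j = i.+2 %[mod 3]].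
  rewrite -(addn2 i) -(addn1 i) -(modnDml i 1) -(modnDml i 2).
  have := ltn_pmod i (isT : (0 < 3)%N); have := ltn_pmod j (isT : (0 < 3)%N).
  case: (i %% 3)%N => [|[|[|]]] //; case: (j %% 3)%N => [|[|[|]]] // _ _;
    first [by apply: Or31 | by apply: Or32 | by apply: Or33].
by rewrite s_srefl; case: h3 => h; rewrite (eq_srefl _ h) -s_srefl;
  [exists i, (- k) | exists i.+2, (- 1 - k) | exists i.+1, (- 1 - k)] => v;
  rewrite (s_srefl_same, s_srefl_next, s_srefl_prev).
Qed.

(** Every conjugate w s_i w^-1 is thus a reflection in some H_{alpha,k}; the form with w on the
    right of the reflection avoids inverses. *)
Lemma prods_s L i : exists j k, forall v, prods L (s i v) = srefl j k (prods L v).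
Proof.
elim: L => [|m L [j [k IH]]]; first by exists i, 0 => v; rewrite s_srefl.
have [j' [k' h]] := s_srefl_commute j k m.
by exists j', k' => v; rewrite /= IH h.
Qed.

(* Conjugating by simple reflections changes k into -k, or into -1-k together
   with the root; these two moves generate all shifts of k. *)
Lemma srefl_conj i k :
  exists L j, forall v, srefl i k (prods L v) = prods L (s j v).
Proof.
pose C i k := exists L j, forall v, srefl i k (prods L v) = prods L (s j v).
have opp i' k' : C i' k' -> C i' (- k').
  move=> [L [j h]]; exists (i' :: L), j => v.
  by rewrite /= -s_srefl_same h.
have nat_case (n : nat) i' : C i' n%:Z.
  elim: n i' => [|n IHn] i'; first by exists [::], i' => v; rewrite -s_srefl.
  have [L [j h]] := IHn i'.+1.
  (* Conjugation by s_{i'+2} takes the root of index i'+1 to that of index i'+3, which is i' modulo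
     3, and n to -1-n; [opp] then gives n+1. *)
  have : C i' (- 1 - n%:Z).
    exists (i'.+2 :: L), j => v.
    by rewrite /= -h s_srefl_next (@eq_srefl i'.+3 i').
  move/opp; rewrite opprD opprK; by congr (C i' _); lia.
case: k => n; first exact: nat_case.
by rewrite NegzE; apply/opp/nat_case.
Qed.

Lemma prods_cat L L' v : prods (L ++ L') v = prods L (prods L' v).
Proof. by elim: L => //= m L ->. Qed.

Lemma sK i v : s i (s i v) = v.
Proof. by rewrite s_srefl sreflK. Qed.

Lemma prods_revK L v : prods L (prods (rev L) v) = v.
Proof.
elim: L v => //= m L IH v.
by rewrite rev_cons -cats1 prods_cat /= IH sK.
Qed.

Lemma prodsK L v : prods (rev L) (prods L v) = v.
Proof. by rewrite -{2}(revK L) prods_revK. Qed.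

Lemma invf_can (f g : E -> E) : cancel f g -> cancel g f -> invf f = g.
Proof.
move=> fK gK; apply/funext => v; rewrite /invf.
by case: xgetP => [u _ <-|/(_ (g v))]; rewrite ?fK //= gK.
Qed.

Lemma invf_prods L : invf (prods L) = prods (rev L).
Proof. by apply: invf_can => v; rewrite ?prodsK ?prods_revK. Qed.

Definition alc (L : seq nat) : alcove := foldr (fun i A => arefl i 0 A) alcove0 L.

(* [t] is the class modulo 3 of (alpha_1 - alpha_2, v); it separates the three
   vertices of an alcove. *)
Definition vertex (t : int) (A : alcove) (v : E) : Prop :=
  exists x y q : int, [/\ dot a1 v = x%:~R, dot a2 v = y%:~R, x - y = 3 * q + t &
    [&& c1 A - 1 <= x <= c1 A, c2 A - 1 <= y <= c2 A &
        - c3 A - 1 <= x + y <= - c3 A]].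

(** On weights a reflection adds a multiple of a root, and (alpha_1 - alpha_2, -) takes values
    divisible by 3 on roots: the type t of a vertex is invariant under W. *)
Lemma vertex_srefl t A v i k : vertex t A v -> vertex t (arefl i k A) (srefl i k v).
Proof.
move=> [x [y [q [hx hy hq]]]]; case: A => a b c /= hA.
rewrite /vertex dot1_srefl dot2_srefl hx hy /d1_srefl /d2_srefl.
case: (i %% 3)%N => [|[|?]] /=.
- by exists (- 1 - k - y), (- 1 - k - x), q; rewrite !intrB; split=> //; lia.
- exists (2 * k - x), (x + y - k), (k - x + q).
  by rewrite !(intrB, intrD, intrM); split=> //; lia.
- exists (x + y - k), (2 * k - y), (y - k + q).
  by rewrite !(intrB, intrD, intrM); split=> //; lia.
Qed.

Lemma vertex_uniq t A u v : valid A -> vertex t A u -> vertex t A v -> u = v.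
Proof.
rewrite /valid => hA [x [y [q [hx hy hq h]]]] [x' [y' [q' [hx' hy' hq' h']]]].
have [ex ey] : x = x' /\ y = y' by lia.
by apply: (@dot_inj _ P); rewrite ?hx ?hy ?hx' ?hy' ?ex ?ey.
Qed.

Definition affine (w : E -> E) : Prop := forall v,
  w v = w 0 + dot a1 v *: (w 0 - w (- w1)) + dot a2 v *: (w 0 - w (- w2)).

(** The dictionary between W and triples. It records images of typed vertices because a valid triple
    has only one vertex of each type, so that an affine w is determined by A. *)
Definition repr (w : E -> E) (A : alcove) : Prop :=
  [/\ valid A, affine w, vertex 0 A (w 0), vertex (-1) A (w (- w1)) &
      vertex 1 A (w (- w2))].

Lemma repr_srefl w A i k : repr w A -> repr (srefl i k \o w) (arefl i k A).
Proof.
move=> [vA aw h0 h1 h2]; split; first exact: arefl_valid; try exact: vertex_srefl.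
move=> v /=; rewrite {1}aw; apply: (@dot_inj _ P);
  rewrite !(dotDr, dotNr, dotZr, dot1_srefl, dot2_srefl) /d1_srefl /d2_srefl;
  by case: (i %% 3)%N => [|[|?]]; ring.
Qed.

Lemma repr_s w A i : repr w A -> repr (s i \o w) (arefl i 0 A).
Proof. by rewrite s_srefl; apply: repr_srefl. Qed.

Lemma repr_id : repr id alcove0.
Proof.
split=> //.
- by move=> v /=; rewrite !sub0r !opprK add0r -varpi_expand.
- by exists 0, 0, 0; rewrite !dot0r.
- by exists (-1), 0, 0; rewrite !dotNr !dots oppr0.
- by exists 0, (-1), 0; rewrite !dotNr !dots oppr0.
Qed.

Lemma repr_prods L : repr (prods L) (alc L).
Proof. by elim: L => [|i L IH]; [apply: repr_id | apply: repr_s]. Qed.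

Lemma repr_inj w w' A : repr w A -> repr w' A -> w = w'.
Proof.
move=> [vA aw h0 h1 h2] [_ aw' h0' h1' h2']; apply/funext => v.
by rewrite aw aw' (vertex_uniq vA h0 h0') (vertex_uniq vA h1 h1')
  (vertex_uniq vA h2 h2').
Qed.

(* 3 (varpi_i, v) + 1, normalised so as to take at a centre the values A_1 - A_3
   and A_2 - A_3. *)
Definition U (v : E) : R := 2 * dot a1 v + dot a2 v + 1.

Definition V (v : E) : R := dot a1 v + 2 * dot a2 v + 1.

Lemma UV_inj u v : U u = U v -> V u = V v -> u = v.
Proof. by rewrite /U /V => h1 h2; apply: (@dot_inj _ P); lra. Qed.

Lemma UV_cen w A : repr w A ->
  U (cen P w) = (c1 A - c3 A)%:~R /\ V (cen P w) = (c2 A - c3 A)%:~R.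
Proof.
rewrite /repr /valid; move=> [vA _ [x0 [y0 [q0 [hx0 hy0 hq0 h0]]]]].
move=> [x1 [y1 [q1 [hx1 hy1 hq1 h1]]]] [x2 [y2 [q2 [hx2 hy2 hq2 h2]]]].
(* The bounds and the congruences modulo 3 leave one position for each vertex, so the sums over the
   three vertices are functions of A. *)
have ex : x0 + x1 + x2 = 2 * c1 A - c2 A - c3 A - 1 by lia.
have ey : y0 + y1 + y2 = 2 * c2 A - c1 A - c3 A - 1 by lia.
have := congr1 (fun z : int => z%:~R : R) ex; have := congr1 (fun z :
  int => z%:~R : R) ey.
rewrite /U /V /cen !dotZr !dotDr hx0 hx1 hx2 hy0 hy1 hy2 !(intrD, intrB, intrM, intrN).
by move=> ? ?; split; lra.
Qed.

(** Differences fix a triple up to adding one integer to all coordinates. This changes the sum by a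
    multiple of 3, and both sums are 0 or 1. *)
Lemma repr_fun w A B : repr w A -> repr w B -> A = B.
Proof.
move=> hA hB; have [u1 v1] := UV_cen hA; have [u2 v2] := UV_cen hB.
have /intr_inj e1 := etrans (esym u1) u2; have /intr_inj e2 := etrans (esym v1) v2.
case: hA hB => vA _ _ _ _ [vB _ _ _ _].
by move: vA vB; rewrite /valid => vA vB; apply: alcoveP; lia.
Qed.

Lemma cen_inj w w' A B : repr w A -> repr w' B -> cen P w = cen P w' -> w = w'.
Proof.
move=> hA hB e; suff eAB : A = B by rewrite eAB in hA; exact: repr_inj hA hB.
have [u1 v1] := UV_cen hA; have [] := UV_cen hB; rewrite -e u1 v1.
move=> /intr_inj e1 /intr_inj e2; case: hA hB => vA _ _ _ _ [vB _ _ _ _].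
by move: vA vB; rewrite /valid => vA vB; apply: alcoveP; lia.
Qed.

(** Removing descents until the origin is reached spells a word, which [alen_alc] shows to be
    reduced. *)
Lemma alc_surj A : valid A -> exists2 L, alc L = A & size L = alen A.
Proof.
have [n] := ubnP (alen A); elim: n A => // n IHn A hn vA.
have [->|A0] := pselect (A = alcove0); first by exists [::].
have [j hj] := valid_descent vA A0; have := alen_arefl j vA; rewrite hj => hl.
have [|L eL hL] := IHn (arefl j 0 A) _ (arefl_valid j 0 vA); first by lia.
by exists (j :: L) => /=; rewrite ?eL ?areflK // hL hl.
Qed.

Lemma W_repr w : W P w <-> exists A, repr w A.
Proof.
split=> [[L ->]|[A hA]]; first by exists (alc L); apply: repr_prods.
have [L eL _] := alc_surj (let: And5 vA _ _ _ _ := hA in vA).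
by exists L; apply: repr_inj hA _; rewrite -eL; apply: repr_prods.
Qed.

Lemma alen_alc L : (alen (alc L) <= size L)%N.
Proof.
elim: L => //= i L IH; have [vL _ _ _ _] := repr_prods L.
by have := alen_arefl i vL; case: ifP => _; lia.
Qed.

Lemma ell_repr w A : repr w A -> ell P w = alen A.
Proof.
move=> hA; rewrite /ell; have [L eL hL] := alc_surj (let: And5 vA _ _ _ _ := hA in vA).
have ew : w = prods L by apply: repr_inj hA _; rewrite -eL; apply: repr_prods.
have low L' : w = prods L' -> (alen A <= size L')%N.
  by move=> e; rewrite (repr_fun hA (B := alc L')) ?alen_alc // e; apply: repr_prods.
case: xgetP => [n _ [[L' <- e'] hmin]|/(_ (alen A)) []].
  by apply/eqP; rewrite eqn_leq low // -hL hmin.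
by split=> //; exists L.
Qed.

(** Right multiplication by t is left multiplication by u t u^-1, that is, a reflection of the
    alcove of u. Conversely [srefl_conj] writes a given reflection as L s_j L^-1, and t is the
    conjugate of s_j by u^-1 L. *)
Lemma bruhat_step_repr u v A B : repr u A -> repr v B ->
  bruhat_step P u v <-> astep A B.
Proof.
move=> hA hB; rewrite /bruhat_step /astep (ell_repr hA) (ell_repr hB).
have [M eu] : W P u by apply/W_repr; exists A.
split=> [[_ [t [w [L ew] [i et]] ev] hl]|[[i [k eB]] hl]]; split=> //.
- have [j [k h]] := prods_s (M ++ L) i; exists j, k.
  apply: (repr_fun hB); have -> : v = srefl j k \o u; last exact: repr_srefl.
  apply/funext => z; rewrite ev et eu ew /= invf_prods.
  by rewrite -prods_cat h prods_cat prods_revK.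
- by exists M.
- have [L [j h]] := srefl_conj i k.
  pose w := prods (rev M ++ L); exists (w \o s j \o invf w).
    by exists w; [exists (rev M ++ L) | exists j].
  have -> : v = srefl i k \o u.
    by apply: (repr_inj hB); rewrite eB; apply: repr_srefl.
  apply/funext => z; rewrite /w /= invf_prods rev_cat revK eu !prods_cat.
  by rewrite prods_revK -h prods_revK.
Qed.

Lemma bruhat_W u v : bruhat P u v -> W P u -> W P v.
Proof.
elim=> // {}u {}v; last by move=> w _ h1 _ h2 /h1.
move=> [[M eu] [t [w [L ew] [i et]] ev] _] _.
exists (M ++ (L ++ (i :: rev L))); rewrite ev et eu ew invf_prods.
by apply/funext => z; rewrite /= !prods_cat.
Qed.

Lemma bruhat_repr u v A B : repr u A -> repr v B -> bruhat P u v <-> abruhat A B.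
Proof.
move=> hA hB; split=> h.
  elim: h A B hA hB => {u v} [u v h|u|u v w h1 IH1 h2 IH2] A B hA hB.
  - by apply: abruhat_step; apply/(bruhat_step_repr hA hB).
  - by rewrite (repr_fun hA hB); apply: rt_refl.
  have /W_repr[C hC] : W P v by apply: (bruhat_W h1); apply/W_repr; exists A.
  exact: abruhat_trans (IH1 _ _ hA hC) (IH2 _ _ hC hB).
elim: h u v hA hB => {A B} [A B h|A|A B C h1 IH1 h2 IH2] u v hA hB.
- by apply: rt_step; apply/(bruhat_step_repr hA hB).
- by rewrite (repr_inj hA hB); apply: rt_refl.
have vB : valid B by apply: (abruhat_valid h1); case: hA.
have [L eL _] := alc_surj vB; have hL := repr_prods L; rewrite eL in hL.
exact: rt_trans (IH1 _ _ hA hL) (IH2 _ _ hL hB).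
Qed.

Theorem bruhat_hexle u v A B : repr u A -> repr v B ->
  bruhat P u v <-> hexle A B.
Proof.
move=> hA hB; rewrite (bruhat_repr hA hB).
by case: hA hB => vA _ _ _ _ [vB _ _ _ _]; apply: abruhatP.
Qed.

End Alcoves.

(** * Symmetries of the Bruhat order *)

Section Symmetries.
Variables (R : realType) (P : rootsA2 R).

Local Notation a1 := (alpha1 P).
Local Notation a2 := (alpha2 P).
Local Notation s := (s P).
Local Notation prods := (prods P).
Local Notation delta := (delta P).
Local Notation sigma := (sigma P).
Local Notation repr := (repr P).
Local Notation U := (U P).
Local Notation V := (V P).

Lemma dot1_sigma v : dot a1 (sigma v) = dot a2 v.
Proof.
rewrite /sigma dotBr dotZr !dot_rho /rho !dotDr (dotC a2 a1).
by rewrite (dot_alpha11, dot_alpha22) dot_alpha12 dot_alpha22; field.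
Qed.

Lemma dot2_sigma v : dot a2 (sigma v) = dot a1 v.
Proof.
rewrite /sigma dotBr dotZr !dot_rho /rho !dotDr (dotC a2 a1).
by rewrite (dot_alpha11, dot_alpha22) dot_alpha12 dot_alpha22; field.
Qed.

Lemma sigmaK : involutive sigma.
Proof. by move=> v; apply: (@dot_inj _ P); rewrite !(dot1_sigma, dot2_sigma). Qed.

Lemma sigma_delta v : sigma (delta v) = delta (delta (sigma v)).
Proof.
apply: (@dot_inj _ P);
by rewrite !(dot1_sigma, dot2_sigma, dot1_delta, dot2_delta,
  dotr_delta) ?dot_rho ?(dot1_sigma, dot2_sigma); ring.
Qed.

Lemma delta_s i v : delta (s i v) = s i.+1 (delta v).
Proof.
rewrite !s_srefl; apply: (@dot_inj _ P);
  rewrite !(dot1_delta, dot2_delta, dot1_srefl, dot2_srefl,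
    dot_rho) /d1_srefl /d2_srefl;
  rewrite -(addn1 i) -(modnDml i 1); have := ltn_pmod i (isT : (0 < 3)%N);
  by case: (i %% 3)%N => [|[|[|]]] //= _; rewrite ?(dot1_delta, dot2_delta,
    dot_rho); ring.
Qed.

Lemma sigma_s i v : sigma (s i v) = s (2 * i) (sigma v).
Proof.
rewrite !s_srefl; apply: (@dot_inj _ P);
  rewrite !(dot1_sigma, dot2_sigma, dot1_srefl, dot2_srefl,
    dot_rho) /d1_srefl /d2_srefl;
  rewrite -(modnMmr 2 i); have := ltn_pmod i (isT : (0 < 3)%N);
  by case: (i %% 3)%N => [|[|[|]]] //= _; ring.
Qed.

Lemma invf_delta : invf delta = delta \o delta.
Proof. by apply: invf_can => v /=; rewrite delta_order3. Qed.

Lemma invf_sigma : invf sigma = sigma.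
Proof. by apply: invf_can; apply: sigmaK. Qed.

Lemma conjf_delta_prods L : conjf delta (prods L) = prods (map S L).
Proof.
apply/funext => v; rewrite /conjf invf_delta /=.
elim: L => /= [|i L IH]; first by rewrite delta_order3.
by rewrite delta_s IH.
Qed.

Lemma conjf_sigma_prods L : conjf sigma (prods L) = prods (map (muln 2) L).
Proof.
apply/funext => v; rewrite /conjf invf_sigma /=.
elim: L => /= [|i L IH]; first by rewrite sigmaK.
by rewrite sigma_s IH.
Qed.

Lemma alc_rot L : alc (map S L) = arot (alc L).
Proof. by elim: L => //= i L ->; rewrite arefl_rot. Qed.

Lemma alc_swap L : alc (map (muln 2) L) = aswap (alc L).
Proof. by elim: L => //= i L ->; rewrite arefl_swap. Qed.

Lemma repr_word w A : repr w A -> exists2 L, w = prods L & alc L = A.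
Proof.
move=> hA; have [L eL _] := alc_surj (let: And5 vA _ _ _ _ := hA in vA).
by exists L => //; apply: repr_inj hA _; rewrite -eL; apply: repr_prods.
Qed.

Lemma repr_delta w A : repr w A -> repr (conjf delta w) (arot A).
Proof.
by move=> /repr_word[L -> <-]; rewrite conjf_delta_prods -alc_rot; apply: repr_prods.
Qed.

Lemma repr_sigma w A : repr w A -> repr (conjf sigma w) (aswap A).
Proof.
by move=> /repr_word[L -> <-]; rewrite conjf_sigma_prods -alc_swap; apply: repr_prods.
Qed.

Lemma U_delta v : U (delta v) = - V v.
Proof. by rewrite /U /V dot1_delta dot2_delta dot_rho; ring. Qed.

Lemma V_delta v : V (delta v) = U v - V v.
Proof. by rewrite /U /V dot1_delta dot2_delta dot_rho; ring. Qed.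

Lemma U_sigma v : U (sigma v) = V v.
Proof. by rewrite /U /V dot1_sigma dot2_sigma; ring. Qed.

Lemma V_sigma v : V (sigma v) = U v.
Proof. by rewrite /U /V dot1_sigma dot2_sigma; ring. Qed.

Lemma cen_delta w A : repr w A -> cen P (conjf delta w) = delta (cen P w).
Proof.
move=> hA; have [u v] := UV_cen hA; have [] := UV_cen (repr_delta hA).
case: A hA u v => a b c _ /= u v u' v'.
by apply: (@UV_inj _ P); rewrite (U_delta, V_delta) ?u ?v ?u' ?v' !intrB; ring.
Qed.

Lemma cen_sigma w A : repr w A -> cen P (conjf sigma w) = sigma (cen P w).
Proof.
move=> hA; have [u v] := UV_cen hA; have [] := UV_cen (repr_sigma hA).
case: A hA u v => a b c _ /= u v u' v'.
by apply: (@UV_inj _ P); rewrite (U_sigma, V_sigma) ?u ?v ?u' ?v'.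
Qed.

Lemma W_prods L : W P (prods L). Proof. by exists L. Qed.

Lemma W_comp u v : W P u -> W P v -> W P (u \o v).
Proof.
by move=> [L ->] [M ->]; exists (L ++ M); apply/funext => z; rewrite prods_cat.
Qed.

Lemma W_inv u : W P u -> W P (invf u).
Proof. by move=> [L ->]; rewrite invf_prods; apply: W_prods. Qed.

Lemma ell_inv u : W P u -> ell P (invf u) = ell P u.
Proof.
have le w : W P w -> (ell P (invf w) <= ell P w)%N.
  move=> /W_repr[A hA]; rewrite (ell_repr hA).
  have [L eL hL] := alc_surj (let: And5 vA _ _ _ _ := hA in vA).
  have -> : w = prods L by apply: repr_inj hA _; rewrite -eL; apply: repr_prods.
  rewrite invf_prods (ell_repr (repr_prods P (rev L))) -hL -(size_rev L).
  exact: (alen_alc P).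
move=> hu; apply/eqP; rewrite eqn_leq le //=.
have {1}-> : u = invf (invf u); last exact/le/W_inv.
by case: hu => L ->; rewrite !invf_prods revK.
Qed.

(** If v = u t then v^-1 = t u^-1 = u^-1 (u t u^-1), again a step. The argument works with words,
    since inversion has no simple effect on triples. *)
Lemma bruhat_inv u v : W P u -> bruhat P u v -> bruhat P (invf u) (invf v).
Proof.
move=> + h; elim: h => {u v} [u v h Wu|u _|u v w h1 IH1 h2 IH2 Wu].
- have Wv := bruhat_W (rt_step _ _ _ _ h) Wu.
  apply: rt_step; case: h => _ [t [w [L ew] [i et]] ev] hl.
  split; [exact: W_inv| |by rewrite !ell_inv].
  case: Wu => M eu; pose N := M ++ L.
  exists (prods N \o s i \o invf (prods N)).
    by exists (prods N); [apply: W_prods | exists i].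
  have -> : v = prods (M ++ (L ++ (i :: rev L))).
    by apply/funext => z; rewrite ev et eu ew invf_prods /= !prods_cat.
  rewrite eu !invf_prods /N; apply/funext => z.
  by rewrite /= !rev_cat rev_cons revK !prods_cat -cats1 !prods_cat /= prodsK.
- exact: rt_refl.
by apply: rt_trans (IH1 Wu) (IH2 (bruhat_W h1 Wu)).
Qed.

Lemma bruhat_delta u v : W P u -> W P v -> bruhat P u v ->
  bruhat P (conjf delta u) (conjf delta v).
Proof.
move=> /W_repr[A hA] /W_repr[B hB] /(bruhat_hexle hA hB) h.
exact/(bruhat_hexle (repr_delta hA) (repr_delta hB))/hexle_rot.
Qed.

Lemma bruhat_sigma u v : W P u -> W P v -> bruhat P u v ->
  bruhat P (conjf sigma u) (conjf sigma v).
Proof.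
move=> /W_repr[A hA] /W_repr[B hB] /(bruhat_hexle hA hB) h.
exact/(bruhat_hexle (repr_sigma hA) (repr_sigma hB))/hexle_swap.
Qed.

(** Needed for the last clause of [polygon], where g may involve inversion. *)
Lemma G_bruhat g : G P g -> (forall u, W P u -> W P (g u)) /\
  (forall u v, W P u -> W P v -> bruhat P u v -> bruhat P (g u) (g v)).
Proof.
elim=> [|f h Sf _ [IHW IHb]]; first by split.
suff [fW fb] : (forall u, W P u -> W P (f u)) /\
    (forall u v, W P u -> W P v -> bruhat P u v -> bruhat P (f u) (f v)).
  split=> [u Wu|u v Wu Wv uv] /=; first exact/fW/IHW.
  by apply: fb; [exact: IHW | exact: IHW | exact: IHb].
case: Sf => [[|]|] ->.
- split; last exact: bruhat_delta.
  by move=> u /W_repr[A hA]; apply/W_repr; exists (arot A); apply: repr_delta.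
- split; last exact: bruhat_sigma.
  by move=> u /W_repr[A hA]; apply/W_repr; exists (aswap A); apply: repr_sigma.
- by split; [apply: W_inv | move=> u v Wu _; apply: bruhat_inv].
Qed.

Lemma cen_id_Aplus : Aplus P (cen P id).
Proof.
have [] := UV_cen (repr_id P); rewrite /U /V /= subrr => u v.
by rewrite /Aplus /= dot_rho; split; lra.
Qed.

Lemma affine_cen w A : repr w A -> w (cen P id) = cen P w.
Proof.
move=> [_ aw _ _ _]; have [] := UV_cen (repr_id P); rewrite /U /V /= subrr => u v.
have e1 : dot a1 (cen P id) = - 3^-1 by lra.
have e2 : dot a2 (cen P id) = - 3^-1 by lra.
rewrite aw e1 e2 /cen; apply: (@dot_inj _ P);
  by rewrite !(dotDr, dotZr, dotNr); field.
Qed.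

Lemma D_repr w A : repr w A -> D P w <-> dominant A.
Proof.
move=> hA; have cA := affine_cen hA; have [u v] := UV_cen hA.
case: (hA) => vA aw [x0 [y0 [q0 [hx0 hy0 hq0 h0]]]].
move=> [x1 [y1 [q1 [hx1 hy1 hq1 h1]]]] [x2 [y2 [q2 [hx2 hy2 hq2 h2]]]].
move: vA; rewrite /valid => vA.
split=> [[_ DA]|dA].
  have [] : Cplus P (cen P w) by apply: DA; exists (cen P id) => //; apply:
    cen_id_Aplus.
  move: u v; rewrite /U /V !intrB => u v h1' h2'.
  have : (0 : R) < (2 * (c1 A - c3 A) - (c2 A - c3 A) - 1)%:~R.
    by rewrite !(intrB, intrM); lra.
  have : (0 : R) < (2 * (c2 A - c3 A) - (c1 A - c3 A) - 1)%:~R.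
    by rewrite !(intrB, intrM); lra.
  by rewrite !ltr0z /dominant; lia.
split; first by apply/W_repr; exists A.
move=> _ [p [pa1 pa2 par] <-]; move: dA; rewrite /dominant => dA.
(* The l's will be the barycentric coordinates of a point of A_+, all positive; the m's are the
   values of a simple root at the three vertices of the image, nonnegative and not all zero. *)
have pos (l0 l1 l2 : R) (m0 m1 m2 : int) : 0 < l0 -> 0 < l1 -> 0 < l2 ->
    0 <= m0 -> 0 <= m1 -> 0 <= m2 -> 0 < m0 + m1 + m2 ->
    0 < l0 * m0%:~R + l1 * m1%:~R + l2 * m2%:~R.
  move=> p0 p1 p2 n0 n1 n2 np.
  have g (l : R) (m : int) : 0 < l -> 0 <= m -> 0 <= l * m%:~R.
    by move=> pl nm; rewrite mulr_ge0 ?ler0z // ltW.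
  have g' (l : R) (m : int) : 0 < l -> 0 < m -> 0 < l * m%:~R.
    by move=> pl nm; rewrite mulr_gt0 ?ltr0z.
  have := (g _ _ p0 n0, g _ _ p1 n1, g _ _ p2 n2) => -[[? ?] ?].
  have /orP[/orP[]|] : (0 < m0) || (0 < m1) || (0 < m2) by clear -n0 n1 n2 np; lia.
  - by move/(g' _ _ p0) => ?; lra.
  - by move/(g' _ _ p1) => ?; lra.
  - by move/(g' _ _ p2) => ?; lra.
move: par; rewrite dot_rho => par.
have l0 : 0 < 1 + dot a1 p + dot a2 p by lra.
have l1 : 0 < - dot a1 p by lra.
have l2 : 0 < - dot a2 p by lra.
have [[? ? ? ?] [? ? ? ?]] :
    [/\ 0 <= x0, 0 <= x1, 0 <= x2 & 0 < x0 + x1 + x2] /\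
    [/\ 0 <= y0, 0 <= y1, 0 <= y2 & 0 < y0 + y1 + y2].
  by clear -vA hq0 hq1 hq2 h0 h1 h2 dA; split; split; lia.
rewrite /Cplus /= aw !(dotDr, dotZr, dotNr) hx0 hx1 hx2 hy0 hy1 hy2; split.
- by have := @pos _ _ _ x0 x1 x2 l0 l1 l2; move=> h; apply:
    (lt_le_trans (h _ _ _ _)) => //; lra.
- by have := @pos _ _ _ y0 y1 y2 l0 l1 l2; move=> h; apply:
    (lt_le_trans (h _ _ _ _)) => //; lra.
Qed.

End Symmetries.

(** * Convex hexagons *)

Section Polygons.
Variables (R : realType) (P : rootsA2 R).

Local Notation E := 'rV[R]_2.
Local Notation a1 := (alpha1 P).
Local Notation a2 := (alpha2 P).
Local Notation w1 := (varpi1 P).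
Local Notation w2 := (varpi2 P).
Local Notation s := (s P).
Local Notation delta := (delta P).
Local Notation repr := (repr P).
Local Notation U := (U P).
Local Notation V := (V P).

Lemma s0D_repr y A : repr y A -> s0D P y <-> antidominant A.
Proof.
move=> hA; have hsA := repr_s 0 hA.
have -> : antidominant A = dominant (arefl 0 0 A).
  case: A hA {hsA} => a b c [vA _ _ _ _]; move: vA.
  by rewrite /valid /antidominant /dominant /= => vA;
    apply/and3P/and3P => -[? ? ?]; split; lia.
rewrite -(D_repr hsA); split=> [[w Dw <-]|Dy].
  by have -> : s 0 \o (s 0 \o w) = w by apply/funext => v /=; rewrite sK.
by exists (s 0 \o y) => //; apply/funext => v /=; rewrite sK.
Qed.

Definition alcx (k : nat) : alcove := Alcove (uphalf k)%:Z 0 (- (k./2)%:Z).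

(** The recursion is x_{k+1} = s_1 delta(x_k). *)
Lemma repr_xk k : repr (xk P k) (alcx k).
Proof.
rewrite /xk; have -> : alcx k = alc (iota 1 k); last exact: repr_prods.
elim: k => //= k IHk; rewrite (iotaDl 1 1) (eq_map (add1n)) alc_rot -IHk.
by apply: alcoveP => /=; lia.
Qed.

Lemma strip_repr x A : repr x A ->
  strip P x <-> [&& c1 A == 0, c2 A <= 0 & 1 <= c3 A].
Proof.
move=> hA; have conjK : forall w, conjf (invf delta) (conjf delta w) = w.
  move=> w; apply/funext => v; rewrite /conjf invf_delta /=.
  by rewrite (@invf_can _ (delta \o delta) delta) => [|z|z] /=; rewrite !delta_order3.
have conjK' : forall w, conjf delta (conjf (invf delta) w) = w.
  move=> w; apply/funext => v; rewrite /conjf invf_delta /=.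
  by rewrite (@invf_can _ (delta \o delta) delta) => [|z|z] /=; rewrite !delta_order3.
have hd := repr_delta hA.
have strip_alcx : strip P x <-> exists2 k, (1 <= k)%N & arot A = alcx k.
  split=> -[k k1 e]; exists k => //.
    by apply: (repr_fun hd); rewrite e conjK'; apply: repr_xk.
  by rewrite -(conjK x); congr conjf; apply: (repr_inj hd); rewrite e; apply: repr_xk.
rewrite strip_alcx; case: A hA {hd strip_alcx} => a b c [vA _ _ _ _] /=.
move: vA; rewrite /valid /= => vA; split=> [[k k1 [-> -> eb]]|/and3P[a0 b0 c0]].
  by lia.
(* The first coordinate vanishes, so this k is the length of x. *)
by exists (`|c| + `|b|)%N; [lia | apply: alcoveP => /=; lia].
Qed.

Definition pt (u v : R) : E :=
  ((2 * u - v - 1) / 3) *: w1 + ((2 * v - u - 1) / 3) *: w2.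

Lemma U_pt u v : U (pt u v) = u.
Proof.
rewrite /U /pt !dotDr !dotZr !(dotC a1) !(dotC a2).
by rewrite dot_varpi11 dot_varpi12 dot_varpi21 dot_varpi22; field.
Qed.

Lemma V_pt u v : V (pt u v) = v.
Proof.
rewrite /V /pt !dotDr !dotZr !(dotC a1) !(dotC a2).
by rewrite dot_varpi11 dot_varpi12 dot_varpi21 dot_varpi22; field.
Qed.

Lemma ptUV v : pt (U v) (V v) = v.
Proof. by apply: (@UV_inj _ P); rewrite ?U_pt ?V_pt. Qed.

Lemma cen_pt w A : repr w A -> cen P w = pt (c1 A - c3 A)%:~R (c2 A - c3 A)%:~R.
Proof. by case/UV_cen => <- <-; rewrite ptUV. Qed.

Lemma pt_comb t u v u' v' :
  t *: pt u v + (1 - t) *: pt u' v' = pt (t * u + (1 - t) * u') (t * v + (1 - t) * v').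
Proof.
apply: (@UV_inj _ P); rewrite ?U_pt ?V_pt /U /V !dotDr !dotZr.
- by rewrite -[u in RHS](U_pt u v) -[u' in RHS](U_pt u' v') /U; ring.
- by rewrite -[v in RHS](V_pt u v) -[v' in RHS](V_pt u' v') /V; ring.
Qed.

Lemma convex_setP (K : set E) : @convex_set R E K <->
  (forall p q t, 0 <= t <= 1 -> K p -> K q -> K (t *: p + (1 - t) *: q)).
Proof.
split=> [cK p q t /andP[t0 t1] Kp Kq|cK p q t /set_mem Kp /set_mem Kq].
  have := cK p q (Itv01 t0 t1) (mem_set Kp) (mem_set Kq).
  by move/set_mem.
apply/mem_set; apply: (cK p q t%:num) => //.
by rewrite ge0 le1.
Qed.

Lemma convex_segment (K : set E) p q r t : @convex_set R E K -> K p -> K q ->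
  0 <= t <= 1 -> U r = t * U p + (1 - t) * U q -> V r = t * V p + (1 - t) * V q ->
  K r.
Proof.
move=> /convex_setP cK Kp Kq t01 hu hv.
by rewrite -(ptUV r) hu hv -pt_comb !ptUV; apply: cK.
Qed.

Lemma convex_line (K : set E) m n u1 u2 u : @convex_set R E K ->
  K (pt u1 (m * u1 + n)) -> K (pt u2 (m * u2 + n)) -> u1 <= u <= u2 ->
  K (pt u (m * u + n)).
Proof.
move=> cK K1 K2 /andP[h1 h2]; have [e|ne] := eqVneq u1 u2.
  by have -> : u = u1 by lra.
have lt12 : 0 < u2 - u1 by rewrite subr_gt0 lt_neqAle ne (le_trans h1).
apply: (@convex_segment K _ _ _ ((u2 - u) / (u2 - u1)) cK K1 K2).
- by rewrite divr_ge0 ?ler_pdivrMr //=; lra.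
- by rewrite !U_pt; field; rewrite gt_eqF.
- by rewrite !V_pt; field; rewrite gt_eqF.
Qed.

Lemma convex_vline (K : set E) u v1 v2 v : @convex_set R E K ->
  K (pt u v1) -> K (pt u v2) -> v1 <= v <= v2 -> K (pt u v).
Proof.
move=> cK K1 K2 /andP[h1 h2]; have [e|ne] := eqVneq v1 v2.
  by have -> : v = v1 by lra.
have lt12 : 0 < v2 - v1 by rewrite subr_gt0 lt_neqAle ne (le_trans h1).
apply: (@convex_segment K _ _ _ ((v2 - v) / (v2 - v1)) cK K1 K2).
- by rewrite divr_ge0 ?ler_pdivrMr //=; lra.
- by rewrite !U_pt; field; rewrite gt_eqF.
- by rewrite !V_pt; field; rewrite gt_eqF.
Qed.

Lemma convex_hexagon (K : set E) (l1 h1 l2 h2 l3 h3 : R) : @convex_set R E K ->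
  K (pt h1 (h1 - h3)) -> K (pt h1 h2) -> K (pt (h2 + l3) h2) ->
  K (pt l1 (l1 - l3)) -> K (pt l1 l2) -> K (pt (l2 + h3) l2) ->
  forall v, l1 <= U v <= h1 -> l2 <= V v <= h2 -> l3 <= U v - V v <= h3 -> K v.
Proof.
move=> cK k1 k2 k3 k4 k5 k6 v; rewrite -[in K v](ptUV v).
move: (U v) (V v) => x y /andP[x1 x2] /andP[y1 y2] /andP[t1 t2].
(* The upper boundary is the side V = h2 to the right of U = h2 + l3 and the side U - V = l3 to its
   left. Likewise the lower one changes at U = l2 + h3 from V = l2 to U - V = h3. *)
have top : exists2 y', y <= y' & K (pt x y').
  have [le|lt] := leP (h2 + l3) x.
    exists h2 => //; have := @convex_line K 0 h2 (h2 + l3) h1 x cK;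
      rewrite !mul0r add0r.
    by apply=> //; rewrite le.
  exists (x - l3); first lra.
  have := @convex_line K 1 (- l3) l1 (h2 + l3) x cK; rewrite !mul1r addrK.
  by apply=> //; rewrite x1 ltW.
have bot : exists2 y', y' <= y & K (pt x y').
  have [le|lt] := leP x (l2 + h3).
    exists l2 => //; have := @convex_line K 0 l2 l1 (l2 + h3) x cK;
      rewrite !mul0r add0r.
    by apply=> //; rewrite x1.
  exists (x - h3); first lra.
  have := @convex_line K 1 (- h3) (l2 + h3) h1 x cK; rewrite !mul1r addrK.
  by apply=> //; rewrite x2 ltW.
case: top bot => [y3 hy3 K3] [y4 hy4 K4].
by apply: convex_vline cK K4 K3 _; rewrite hy4.
Qed.

End Polygons.

(** * Centres in the polygon of y belong to elements below y *)

Section Hulls.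
Variables (R : realType) (P : rootsA2 R).

Local Notation E := 'rV[R]_2.
Local Notation s := (s P).
Local Notation prods := (prods P).
Local Notation delta := (delta P).
Local Notation repr := (repr P).
Local Notation cen := (cen P).
Local Notation U := (U P).
Local Notation V := (V P).

Definition aprods (L : seq nat) (A : alcove) : alcove :=
  foldr (fun i A => arefl i 0 A) A L.

Lemma repr_comp L y B : repr y B -> repr (prods L \o y) (aprods L B).
Proof. by move=> hB; elim: L => //= i L; apply: repr_s. Qed.

Lemma hexle_refl A : hexle A A.
Proof. by rewrite /hexle /cyc_le !le_max !lexx. Qed.

Lemma hexle0 B : valid B -> hexle alcove0 B.
Proof.
case: B => a b c; rewrite /valid /hexle /cyc_le /= !le_max => vB.
by do !split; lia.
Qed.

(** The elements below a dominant X are stable under s_1 and s_2, so the parabolic orbit can be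
    treated letter by letter. *)
Lemma hexle_dominant_refl X A j : valid X -> dominant X -> (j == 1) || (j == 2) ->
  hexle A X -> hexle (arefl j 0 A) X.
Proof.
move=> vX dX hj; rewrite !hexle_dominant //; move: vX dX.
case: X A => [a b c] [a' b' c']; rewrite /valid /dominant /= => vX dX.
by case/orP: hj => /eqP-> /= [[? [? ?]] [? [? ?]]]; do !split; lia.
Qed.

Lemma hexle_antidominant_word X L : valid X -> antidominant X ->
  L \in [:: [::]; [:: 0]; [:: 1; 0]; [:: 2; 0]; [:: 0; 1; 0]; [:: 0; 2; 0]]%N ->
  hexle (aprods L X) X.
Proof.
move=> vX dX hL; rewrite hexle_antidominant //; move: vX dX.
case: X => a b c; rewrite /valid /antidominant /= => vX dX; move: hL.
by rewrite !inE; do 5?[case/orP]; move=> /eqP-> /=; do !split; lia.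
Qed.

(** Two rotations take the alcove of x_k into the strip when k >= 2. *)
Lemma hexle_alcx Z k : (2 <= k)%N ->
  hexle Z (alcx k) <->
  (c1 Z - c3 Z <= (uphalf k)%:Z + (k./2)%:Z /\
   c2 Z - c1 Z <= (uphalf k)%:Z + (k./2)%:Z - 1 /\
   c3 Z - c2 Z <= (uphalf k)%:Z + (k./2)%:Z - 2) /\
  (c1 Z - c2 Z <= (uphalf k)%:Z /\ c3 Z - c1 Z <= (uphalf k)%:Z - 1 /\
   c2 Z - c3 Z <= (k./2)%:Z).
Proof.
move=> k2; rewrite -(hexle_rot Z) -(hexle_rot (arot Z)) hexle_strip.
- by case: Z => a b c /=; rewrite !opprK; split=> -[[? [? ?]] [? [? ?]]];
    do !split; lia.
- by rewrite /valid /=; lia.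
- by rewrite /in_strip /=; lia.
Qed.

Lemma hexle_alcx_word k L : (2 <= k)%N ->
  L \in [:: [::]; [:: 1]; [:: 2; 1]; [:: 1; 2; 1]]%N ->
  hexle (aprods L (alcx k)) (alcx k).
Proof.
move=> k2 hL; apply/hexle_alcx => //; move: hL.
by rewrite !inE; do 3?[case/orP]; move=> /eqP-> /=; do !split; lia.
Qed.

Lemma hull_halfplane (S : set E) (m n c : R) : (forall p, S p ->
  m * U p + n * V p <= c) ->
  forall v, convex_hull S v -> m * U v + n * V v <= c.
Proof.
move=> hS v hv; apply: (hv [set p | m * U p + n * V p <= c]); split=> //.
apply/convex_setP => p q t /andP[t0 t1] /= hp hq.
have -> : m * U (t *: p + (1 - t) *: q) + n * V (t *: p + (1 - t) *: q) =
    t * (m * U p + n * V p) + (1 - t) * (m * U q + n * V q).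
  by rewrite /U /V !dotDr !dotZr; ring.
by nra.
Qed.

(** For fixed B each inequality of [hexle] is a half-plane in the coordinates [U], [V], so it passes
    from points to their hull. *)
Lemma hull_hexle (S : set E) B :
  (forall p, S p -> exists q A, [/\ repr q A, hexle A B & p = cen q]) ->
  forall z Z, repr z Z -> convex_hull S (cen z) -> hexle Z B.
Proof.
move=> hS z Z hZ hz.
have half (m n k : int) : (forall A, hexle A B ->
      m * (c1 A - c3 A) + n * (c2 A - c3 A) <= k) ->
    m * (c1 Z - c3 Z) + n * (c2 Z - c3 Z) <= k.
  move=> hA; have [uZ vZ] := UV_cen hZ.
  have := @hull_halfplane S m%:~R n%:~R k%:~R _ _ hz.
  rewrite uZ vZ -!intrM -intrD ler_int; apply=> p /hS[q [A [rA /hA h ->]]].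
  by have [-> ->] := UV_cen rA; rewrite -!intrM -intrD ler_int.
rewrite /hexle /cyc_le.
have h1 := half 1 0; have h2 := half (-1) 1; have h3 := half 0 (-1).
have h4 := half 0 1; have h5 := half 1 (-1); have h6 := half (-1) 0.
do !split.
- by apply: le_trans (h1 _ _); [lia | move=> A [[h _] _]; apply: le_trans h; lia].
- by apply: le_trans (h2 _ _); [lia | move=> A [[_ [h _]] _]; apply: le_trans h; lia].
- by apply: le_trans (h3 _ _); [lia | move=> A [[_ [_ h]] _]; apply: le_trans h; lia].
- by apply: le_trans (h4 _ _); [lia | move=> A [_ [h _]]; apply: le_trans h; lia].
- by apply: le_trans (h5 _ _); [lia | move=> A [_ [_ [h _]]]; apply: le_trans h; lia].
- by apply: le_trans (h6 _ _); [lia | move=> A [_ [_ [_ h]]]; apply: le_trans h; lia].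
Qed.

Lemma repr_iter_delta n w A : repr w A -> repr (iter n (conjf delta) w) (iter n arot A).
Proof. by move=> hA; elim: n => //= n; apply: repr_delta. Qed.

Lemma arefl_iter_rot n i k A :
  arefl (n + i) k (iter n arot A) = iter n arot (arefl i k A).
Proof. by elim: n => //= n IH; rewrite addSn arefl_rot IH. Qed.

Lemma aprods_iter_rot n L A :
  aprods (map (addn n) L) (iter n arot A) = iter n arot (aprods L A).
Proof. by elim: L => //= i L ->; rewrite arefl_iter_rot. Qed.

Lemma hexle_iter_rot n A B : hexle (iter n arot A) (iter n arot B) <-> hexle A B.
Proof. by elim: n => //= n IH; rewrite hexle_rot. Qed.

Lemma polygon_hexle y B z Z : repr y B -> repr z Z -> polygon P y (cen z) -> hexle Z B.
Proof.
move=> hB hZ; move ez: (cen z) => v0 hv0.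
case: hv0 ez => [v ey ->|i v ey + ez|i v i3 [w Dw ey] + ez|i v i3 [w Dw ey] + ez|g
  k v gG k2 ey + ez];
  rewrite -?ez => hv.
- have e : z = y by rewrite ey; apply: (cen_inj hZ (repr_id P)).
  rewrite e in hZ; rewrite (repr_fun hZ hB); exact: hexle_refl.
- apply: (hull_hexle _ hZ hv) => p [|] ->.
    by exists id, alcove0; split; [apply: repr_id | apply: hexle0; case: hB |].
  by exists (s i), B; split; [rewrite -ey | apply: hexle_refl |].
- have [X hX] : exists X, repr w X by apply/W_repr; case: Dw.
  have eB : B = iter i arot X.
    by apply: (repr_fun hB); rewrite -ey; apply: repr_iter_delta.
  have dX : dominant X by apply/(D_repr hX).
  have vX : valid X by case: hX.
  apply: (hull_hexle _ hZ hv) => p [_ [L hL ->] <-].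
  exists (prods L \o y), (aprods L B); split=> //; first exact: repr_comp.
  (* A word in s_{i+1}, s_{i+2} is the i-fold rotation of a word in s_1, s_2; the induction runs on
     the unrotated side. *)
  have : exists A, aprods L B = iter i arot A /\ hexle A X.
    elim: L hL => [|j L IH] hL; first by exists X; split=> //; apply: hexle_refl.
    have [l lL|A [eA hA]] := IH; first by apply: hL; rewrite inE lL orbT.
    have [j' hj' ej] : exists2 j', (j' == 1%N) || (j' == 2%N) & j = (i + j')%N.
      have := hL j (mem_head _ _); rewrite !inE => /orP[] /eqP->.
        by exists 1%N; rewrite ?addn1.
      by exists 2%N; rewrite ?addn2.
    exists (arefl j' 0 A); rewrite /= eA ej arefl_iter_rot; split=> //.
    exact: hexle_dominant_refl.
  by case=> A [-> hA]; rewrite eB hexle_iter_rot.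
- have [X hX] : exists X, repr w X.
    by apply/W_repr; case: Dw => w' [Ww' _] <-; apply: (W_comp (W_prods P [:: 0%N])).
  have eB : B = iter i arot X.
    by apply: (repr_fun hB); rewrite -ey; apply: repr_iter_delta.
  have dX : antidominant X by apply/(s0D_repr hX).
  have vX : valid X by case: hX.
  have word L : L \in [:: [::]; [:: 0]; [:: 1; 0]; [:: 2; 0]; [:: 0; 1; 0]; [::
    0; 2; 0]]%N ->
      exists q A, [/\ repr q A, hexle A B & cen (prods (map (addn i) L) \o y) = cen q].
    move=> hL; exists (prods (map (addn i) L) \o y), (aprods (map (addn i) L) B).
    split=> //; first exact: repr_comp.
    by rewrite eB aprods_iter_rot hexle_iter_rot; apply: hexle_antidominant_word.
  apply: (hull_hexle _ hZ hv) => p.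
  have e0 : (i + 0)%N = i by rewrite addn0.
  have e1 : (i + 1)%N = i.+1 by rewrite addn1.
  have e2 : (i + 2)%N = i.+2 by rewrite addn2.
  move=> [[[[[|]|]|]|]|] ->.
  + exact: (word [::]).
  + by have := word [:: 0%N] isT; rewrite /= e0.
  + by have := word [:: 1%N; 0%N] isT; rewrite /= e0 e1.
  + by have := word [:: 2%N; 0%N] isT; rewrite /= e0 e2.
  + by have := word [:: 0%N; 1%N; 0%N] isT; rewrite /= e0 e1.
  + by have := word [:: 0%N; 2%N; 0%N] isT; rewrite /= e0 e2.
(* Here g need not be an isometry: the corners are compared with x_k first, and g then transports
   the Bruhat relation. *)
have [gW gb] := G_bruhat gG.
have hk := repr_xk P k.
have Wk : W P (xk P k) by apply: W_prods.
have word L : L \in [:: [::]; [:: 1]; [:: 2; 1]; [:: 1; 2; 1]]%N ->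
    exists q A, [/\ repr q A, hexle A B & cen (g (prods L \o xk P k)) = cen q].
  move=> hL; have hL' := repr_comp L hk.
  have WL : W P (prods L \o xk P k) by apply/W_repr; exists (aprods L (alcx k)).
  have /W_repr[A hA] := gW _ WL.
  exists (g (prods L \o xk P k)), A; split=> //.
  apply/(bruhat_hexle hA hB); rewrite ey; apply: gb => //.
  exact/(bruhat_hexle hL' hk)/hexle_alcx_word.
apply: (hull_hexle _ hZ hv) => p; move=> [[[|]|]|] ->.
+ exact: (word [::]).
+ exact: (word [:: 1%N]).
+ exact: (word [:: 2%N; 1%N]).
+ exact: (word [:: 1%N; 2%N; 1%N]).
Qed.

End Hulls.

(** * Elements below y have their centres in the polygon of y *)

Section HexlePolygon.
Variables (R : realType) (P : rootsA2 R).

Local Notation E := 'rV[R]_2.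
Local Notation s := (s P).
Local Notation prods := (prods P).
Local Notation delta := (delta P).
Local Notation sigma := (sigma P).
Local Notation repr := (repr P).
Local Notation cen := (cen P).
Local Notation pt := (pt P).

Lemma convex_hexagon_cen (K : set E) (l1 h1 l2 h2 l3 h3 : int) : @convex_set R E K ->
  K (pt h1%:~R (h1 - h3)%:~R) -> K (pt h1%:~R h2%:~R) ->
  K (pt (h2 + l3)%:~R h2%:~R) -> K (pt l1%:~R (l1 - l3)%:~R) ->
  K (pt l1%:~R l2%:~R) -> K (pt (l2 + h3)%:~R l2%:~R) ->
  forall z Z, repr z Z -> l1 <= c1 Z - c3 Z <= h1 -> l2 <= c2 Z - c3 Z <= h2 ->
    l3 <= c1 Z - c2 Z <= h3 -> K (cen z).
Proof.
rewrite !intrB !intrD => cK k1 k2 k3 k4 k5 k6 z Z hZ hu hv ht.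
have [uZ vZ] := UV_cen hZ.
apply: (convex_hexagon cK k1 k2 k3 k4 k5 k6); rewrite ?uZ ?vZ ?ler_int //.
by rewrite -intrB !ler_int; lia.
Qed.

Lemma hexagon_dominant (K : set E) y X : @convex_set R E K -> repr y X -> dominant X ->
  (forall L, {subset L <= [:: 1; 2]%N} -> K (cen (prods L \o y))) ->
  forall z Z, repr z Z -> hexle Z X -> K (cen z).
Proof.
move=> cK hX dX hK z Z hZ; have vX : valid X by case: hX.
rewrite hexle_dominant // => -[[? [? ?]] [? [? ?]]].
have KL L (m n : int) : all (mem [:: 1; 2]%N) L ->
    c1 (aprods L X) - c3 (aprods L X) = m -> c2 (aprods L X) - c3 (aprods L X) = n ->
    K (pt m%:~R n%:~R).
  by move=> /allP hL <- <-; rewrite -(cen_pt (repr_comp L hX)); apply: hK.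
apply: (@convex_hexagon_cen K (2 - (c2 X - c3 X)) (c1 X - c3 X)
  (2 - (c1 X - c3 X)) (c2 X - c3 X) (1 - (c1 X - c3 X)) (c2 X - c3 X - 1) cK) hZ _ _ _;
  try lia.
- by apply: (KL [:: 2%N]) => //; case: (X) => a b c /=; lia.
- by apply: (KL [::]).
- by apply: (KL [:: 1%N]) => //; case: (X) => a b c /=; lia.
- by apply: (KL [:: 1%N; 2%N]) => //; case: (X) => a b c /=; lia.
- by apply: (KL [:: 1%N; 2%N; 1%N]) => //; case: (X) => a b c /=; lia.
- by apply: (KL [:: 2%N; 1%N]) => //; case: (X) => a b c /=; lia.
Qed.

Lemma hexagon_antidominant (K : set E) y X :
  @convex_set R E K -> repr y X -> antidominant X ->
  (forall L, L \in [:: [::]; [:: 0]; [:: 1; 0]; [:: 2; 0]; [:: 0; 1; 0]; [:: 0;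
    2; 0]]%N ->
     K (cen (prods L \o y))) ->
  forall z Z, repr z Z -> hexle Z X -> K (cen z).
Proof.
move=> cK hX dX hK z Z hZ; have vX : valid X by case: hX.
rewrite hexle_antidominant // => -[[? [? ?]] [? [? ?]]].
have KL L (m n : int) : L \in [:: [::]; [:: 0]; [:: 1; 0]; [:: 2; 0]; [:: 0; 1;
  0]; [:: 0; 2; 0]]%N ->
    c1 (aprods L X) - c3 (aprods L X) = m -> c2 (aprods L X) - c3 (aprods L X) = n ->
    K (pt m%:~R n%:~R).
  by move=> hL <- <-; rewrite -(cen_pt (repr_comp L hX)); apply: hK.
apply: (@convex_hexagon_cen K (c1 X - c3 X) (c3 X - c2 X - 1)
  (c2 X - c3 X) (c3 X - c1 X - 1) (2 - (c3 X - c2 X)) (c3 X - c1 X - 2) cK) hZ _ _ _;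
  try lia.
- by apply: (KL [:: 2%N; 0%N]) => //; case: (X) => a b c /=; lia.
- by apply: (KL [:: 0%N]) => //; case: (X) => a b c /=; lia.
- by apply: (KL [:: 1%N; 0%N]) => //; case: (X) => a b c /=; lia.
- by apply: (KL [:: 0%N; 1%N; 0%N]) => //; case: (X) => a b c /=; lia.
- by apply: (KL [::]).
- by apply: (KL [:: 0%N; 2%N; 0%N]) => //; case: (X) => a b c /=; lia.
Qed.

(** Two sides of the hexagon have length zero: x_k and s_1 x_k each count as two corners, which
    leaves the four listed centres. *)
Lemma hexagon_xk (K : set E) k : @convex_set R E K -> (2 <= k)%N ->
  (forall L, L \in [:: [::]; [:: 1]; [:: 2; 1]; [:: 1; 2; 1]]%N ->
     K (cen (prods L \o xk P k))) ->
  forall z Z, repr z Z -> hexle Z (alcx k) -> K (cen z).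
Proof.
move=> cK k2 hK z Z hZ; rewrite hexle_alcx // => -[[? [? ?]] [? [? ?]]].
have KL L (m n : int) : L \in [:: [::]; [:: 1]; [:: 2; 1]; [:: 1; 2; 1]]%N ->
    c1 (aprods L (alcx k)) - c3 (aprods L (alcx k)) = m ->
    c2 (aprods L (alcx k)) - c3 (aprods L (alcx k)) = n -> K (pt m%:~R n%:~R).
  by move=> hL <- <-; rewrite -(cen_pt (repr_comp L (repr_xk P k))); apply: hK.
apply: (@convex_hexagon_cen K (1 - (uphalf k)%:Z) ((uphalf k)%:Z + (k./2)%:Z)
  (2 - ((uphalf k)%:Z + (k./2)%:Z)) (k./2)%:Z (1 - ((uphalf k)%:Z + (k./2)%:Z))
  (uphalf k)%:Z cK) hZ _ _ _; try lia.
- by apply: (KL [::]) => //=; lia.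
- by apply: (KL [::]) => //=; lia.
- by apply: (KL [:: 1%N]) => //=; lia.
- by apply: (KL [:: 1%N]) => //=; lia.
- by apply: (KL [:: 2%N; 1%N]) => //=; lia.
- by apply: (KL [:: 1%N; 2%N; 1%N]) => //=; lia.
Qed.

Lemma convex_preim_delta (K : set E) : @convex_set R E K ->
  @convex_set R E (delta @^-1` K).
Proof.
move=> /convex_setP cK; apply/convex_setP => p q t t01 Kp Kq /=.
have -> : delta (t *: p + (1 - t) *: q) = t *: delta p + (1 - t) *: delta q.
  by apply: (@dot_inj _ P); rewrite !(dot1_delta, dot2_delta, dotDr, dotZr); ring.
exact: cK.
Qed.

Lemma convex_preim_sigma (K : set E) : @convex_set R E K ->
  @convex_set R E (sigma @^-1` K).
Proof.
move=> /convex_setP cK; apply/convex_setP => p q t t01 Kp Kq /=.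
have -> : sigma (t *: p + (1 - t) *: q) = t *: sigma p + (1 - t) *: sigma q.
  by apply: (@dot_inj _ P); rewrite !(dot1_sigma, dot2_sigma, dotDr, dotZr).
exact: cK.
Qed.

Lemma convex_preim_iter_delta n (K : set E) :
  @convex_set R E K -> @convex_set R E (iter n delta @^-1` K).
Proof.
elim: n K => // n IH K cK.
have -> : iter n.+1 delta @^-1` K = iter n delta @^-1` (delta @^-1` K) by [].
exact/IH/convex_preim_delta.
Qed.

Lemma cen_iter_delta n w A : repr w A ->
  cen (iter n (conjf delta) w) = iter n delta (cen w).
Proof.
by move=> hA; elim: n => //= n <-; rewrite (cen_delta (repr_iter_delta n hA)).
Qed.

Lemma conjf_delta_comp u v : conjf delta (u \o v) = conjf delta u \o conjf delta v.
Proof. by apply/funext => z; rewrite /conjf /= invf_delta /= delta_order3. Qed.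

Lemma iter_conjf_delta_prods n L y :
  iter n (conjf delta) (prods L \o y) =
  prods (map (addn n) L) \o iter n (conjf delta) y.
Proof.
elim: n => /= [|n ->]; first by rewrite map_id.
rewrite conjf_delta_comp conjf_delta_prods -map_comp.
by congr (prods _ \o _); apply: eq_map.
Qed.

Lemma standard_decomp B : valid B -> exists n (b : bool) X,
  [/\ (n < 3)%N, valid X, standard X & B = iter n arot (if b then aswap X else X)].
Proof.
move: B; apply: alcove_sym_ind => B vB => [[n [b [X [n3 vX sX e]]]]|[n [b [X [n3 vX
  sX e]]]]|sB].
- case: n n3 e => [|[|[|]]] // _ e; [exists 2%N|exists 0%N|exists 1%N]; exists b, X;
    split=> //; move: e; case: (B) => a' b' c'; case: (X) => a'' b'' c'';
    by case: b => /= -[-> -> ->].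
- case: n n3 e => [|[|[|]]] // _ e; [exists 0%N|exists 2%N|exists 1%N];
    exists (~~ b), X;
    split=> //; move: e; case: (B) => a' b' c'; case: (X) => a'' b'' c'';
    by case: b => /= -[-> -> ->].
by exists 0%N, false, B; split.
Qed.

Lemma hull_convex (S : set E) : @convex_set R E (convex_hull S).
Proof.
apply/convex_setP => p q t t01 Sp Sq K [cK SK].
by move/convex_setP: (cK); apply=> //; [apply: Sp | apply: Sq].
Qed.

Lemma hull_sub (S : set E) p : S p -> convex_hull S p.
Proof. by move=> Sp K [_]; apply. Qed.

Lemma G_conj_delta : G P (conjf delta).
Proof.
rewrite -[conjf delta]/(conjf delta \o id); apply: generated_comp; last exact:
  generated_id.
by left; left.
Qed.

Lemma G_comp f g : G P f -> G P g -> G P (f \o g).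
Proof.
move=> + Gg; elim=> // f1 f2 S1 _ IH.
exact: (@generated_comp _ _ f1 (f2 \o g) S1 IH).
Qed.

Lemma G_conj_sigma : G P (conjf sigma).
Proof.
rewrite -[conjf sigma]/(conjf sigma \o id); apply: generated_comp; last exact:
  generated_id.
by left; right.
Qed.

Lemma G_iter_delta n : G P (iter n (conjf delta)).
Proof.
elim: n => [|n IH]; first exact: generated_id.
exact: (G_comp G_conj_delta IH).
Qed.

Lemma polygon_xkP g f k y : G P g -> (forall w A, repr w A -> cen (g w) = f (cen w)) ->
  (forall K : set E, @convex_set R E K -> @convex_set R E (f @^-1` K)) ->
  (2 <= k)%N -> y = g (xk P k) ->
  forall z0 Z0, repr z0 Z0 -> hexle Z0 (alcx k) -> polygon P y (f (cen z0)).
Proof.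
move=> gG hf cf k2 ey z0 Z0 hZ h; apply: (polygon_xk gG k2 ey).
set S := (X in convex_hull X).
suff : (f @^-1` convex_hull S) (cen z0) by [].
apply: (hexagon_xk (cf _ (@hull_convex S)) k2 _ hZ h) => L hL /=.
rewrite -(hf _ _ (repr_comp L (repr_xk P k))); apply: hull_sub; move: hL.
rewrite !inE /S => /or4P[] /eqP->; first by left; left; left.
- by left; left; right.
- by left; right.
- by right.
Qed.

Lemma hexle_polygon y B z Z : repr y B -> repr z Z -> hexle Z B -> polygon P y (cen z).
Proof.
move=> hB hZ hZB; have vB : valid B by case: hB.
have [n [b [X [n3 vX sX eB]]]] := standard_decomp vB.
pose sw A := if b then aswap A else A.
have sw_valid A : valid (sw A) = valid A by rewrite /sw; case: (b); rewrite ?valid_swap.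
have swK A : sw (sw A) = A by rewrite /sw; case: (b); case: (A).
have sw_hexle A A' : hexle (sw A) (sw A') <-> hexle A A'.
  by rewrite /sw; case: (b); rewrite ?hexle_swap.
have [Y [eZ hZY]] : exists Y, Z = iter n arot Y /\ hexle Y (sw X).
  have [Y eY] : exists Y, Z = iter n arot Y.
    case: n n3 {eB} => [|[|[|]]] // _; [exists Z|exists (arot (arot Z))|exists
      (arot Z)];
    by case: (Z).
  by exists Y; split=> //; apply/(hexle_iter_rot n); rewrite -eY -eB.
have real_alc A : valid A -> exists w, repr w A.
  move=> vA; have [L <- _] := alc_surj vA; exists (prods L); exact: repr_prods.
have vsX : valid (sw X) by rewrite sw_valid.
have vY : valid Y.
  have : valid Z by case: hZ.
  by rewrite eZ; elim: (n) => //= m IH; rewrite valid_rot.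
have [y0 hy0] := real_alc _ vsX; have [z0 hz0] := real_alc _ vY.
have ey : y = iter n (conjf delta) y0.
  by apply: (repr_inj hB); rewrite eB; apply: repr_iter_delta.
have ez : z = iter n (conjf delta) z0.
  by apply: (repr_inj hZ); rewrite eZ; apply: repr_iter_delta.
have ecz : cen z = iter n delta (cen z0) by rewrite ez (cen_iter_delta _ hz0).
have cL L : cen (prods (map (addn n) L) \o y) = iter n delta (cen (prods L \o y0)).
  by rewrite ey -iter_conjf_delta_prods (cen_iter_delta _ (repr_comp L hy0)).
case/or4P: sX => sX.
- have dX : dominant (sw X).
    by move: sX; rewrite /sw /dominant; case: (b); case:
      (X) => ? ? ? //= /and3P[-> -> ->].
  apply: (@polygon_D _ P y n) => //.
    by exists y0 => //; apply/(D_repr hy0).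
  rewrite ecz; set S := (X in convex_hull X).
  suff : (iter n delta @^-1` convex_hull S) (cen z0) by [].
  apply: (hexagon_dominant _ hy0 dX _ hz0 hZY).
    exact/convex_preim_iter_delta/hull_convex.
  move=> L hL /=; rewrite -cL; apply: hull_sub; exists (prods (map (addn n) L)) => //.
  exists (map (addn n) L) => // _ /mapP[j jL ->]; have := hL j jL.
  by rewrite !inE => /orP[] /eqP->; rewrite ?addn1 ?addn2 eqxx ?orbT.
- have dX : antidominant (sw X).
    by move: sX; rewrite /sw /antidominant; case: (b); case:
      (X) => ? ? ? //= /and3P[-> -> ->].
  apply: (@polygon_s0D _ P y n) => //.
    by exists y0 => //; apply/(s0D_repr hy0).
  rewrite ecz; set S := (X in convex_hull X).
  suff : (iter n delta @^-1` convex_hull S) (cen z0) by [].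
  apply: (hexagon_antidominant _ hy0 dX _ hz0 hZY).
    exact/convex_preim_iter_delta/hull_convex.
  move=> L hL /=; rewrite -cL; apply: hull_sub; rewrite /S; move: hL.
  rewrite !inE; do 5?[case/orP]; move=> /eqP->; rewrite /= ?addn0 ?addn1 ?addn2.
  + by do 5!left.
  + by do 4!left; right.
  + by do 3!left; right.
  + by do 2!left; right.
  + by left; right.
  + by right.
- have [k k2 eX] : exists2 k, (2 <= k)%N & X = arot (arot (alcx k)).
    case: X sX vX {eB hZY vsX hy0} => a b' c; rewrite /in_strip /valid /= => sX vX.
    by exists (`|c| + `|b'|)%N; [lia | apply: alcoveP => /=; lia].
  (* The element g = delta^n sigma^b delta^2 carries x_k to y. It is chosen without inversion, so
     centres follow the isometry f. *)
  pose f v := iter n delta (if b then sigma (delta (delta v)) else delta (delta v)).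
  pose g w := iter n (conjf delta) (if b then conjf sigma (conjf delta (conjf delta w))
                                  else conjf delta (conjf delta w)).
  have gG : G P g.
    have G2 := G_comp G_conj_delta G_conj_delta.
    rewrite /g; case: (b).
      exact: (G_comp (G_iter_delta n) (G_comp G_conj_sigma G2)).
    exact: (G_comp (G_iter_delta n) G2).
  have hdd w A (h : repr w A) := repr_delta (repr_delta h).
  have hf w A : repr w A -> cen (g w) = f (cen w).
    move=> hA; rewrite /g /f; case: (b).
      rewrite (cen_iter_delta _ (repr_sigma (hdd _ _ hA))) (cen_sigma (hdd _ _ hA)).
      by rewrite (cen_delta (repr_delta hA)) (cen_delta hA).
    by rewrite (cen_iter_delta _ (hdd _ _ hA)) (cen_delta (repr_delta hA))
      (cen_delta hA).
  have cf (K : set E) : @convex_set R E K -> @convex_set R E (f @^-1` K).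
    move=> cK; have := @convex_preim_iter_delta n _ cK; rewrite /f; case: (b) => c.
      exact: (convex_preim_delta (convex_preim_delta (convex_preim_sigma c))).
    exact: (convex_preim_delta (convex_preim_delta c)).
  have [z1 hz1] : exists z1, repr z1 (arot (sw Y)) by apply: real_alc;
    rewrite valid_rot sw_valid.
  have -> : cen z = f (cen z1).
    rewrite ecz /f; congr iter.
    have -> : z0 = if b then conjf sigma (conjf delta (conjf delta z1)) else conjf
      delta (conjf delta z1).
      apply: (repr_inj hz0); rewrite -[Y]swK.
      have -> : sw Y = arot (arot (arot (sw Y))) by case: (sw Y).
      rewrite [X in repr _ X]/sw; case: (b); last exact: hdd.
      exact/repr_sigma/hdd.
    case: (b); last by rewrite (cen_delta (repr_delta hz1)) (cen_delta hz1).
    by rewrite (cen_sigma (hdd _ _ hz1)) (cen_delta (repr_delta hz1)) (cen_delta hz1).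
  apply: (polygon_xkP gG hf cf k2 _ hz1).
    rewrite ey /g; congr iter; apply: (repr_inj hy0); rewrite eX /sw.
    by case: (b); [apply/repr_sigma|]; apply/hdd/repr_xk.
  apply: (proj1 (hexle_rot _ _)); apply: (proj1 (hexle_rot _ _)); rewrite -eX.
  apply: (proj1 (sw_hexle _ _)).
  have -> : arot (arot (arot (sw Y))) = sw Y by case: (sw Y).
  by rewrite swK.
have eX : X = Alcove 0 0 1 \/ X = alcove0.
  case: X sX {eB hZY vsX hy0 vX} => ? ? ? /= /and3P[/eqP-> /eqP-> /orP[] /eqP->];
    [right|left]; by [].
have {eX} [eX|eX] := eX; last first.
  have e0 : B = alcove0.
    by rewrite eB eX; elim: (n) => [|m /= ->] //; case: (b).
  have ey0 : y = id by apply: (repr_inj hB); rewrite e0; apply: repr_id.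
  apply: polygon_id => //; congr cen; rewrite -ey0; apply: (repr_inj hZ).
  suff -> : Z = B by [].
  have : hexle Y alcove0 by move: hZY; rewrite eX /sw; case: (b).
  move=> h; rewrite eZ e0.
  suff -> : Y = alcove0 by elim: (n) => //= m ->.
  move: h vY; case: (Y) => p q r; rewrite /hexle /cyc_le /valid /= => h vY.
  by apply: alcoveP => /=; lia.
have eSw : sw X = Alcove 0 0 1 by rewrite eX /sw; case: (b).
have ey1 : y = s n.
  rewrite ey.
  have -> : y0 = s 0 by apply: (repr_inj hy0); rewrite eSw; apply:
    (repr_s 0 (repr_id P)).
  rewrite -[s 0]/(prods [:: 0%N] \o id) iter_conjf_delta_prods /= addn0.
  have -> : iter n (conjf delta) id = id; last by [].
  apply: (@repr_inj _ P _ _ (iter n arot alcove0)).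
    exact/repr_iter_delta/repr_id.
  by have -> : iter n arot alcove0 = alcove0; [elim: (n) => //= m -> | apply: repr_id].
rewrite eSw in hZY.
apply: (@polygon_s _ P y n) => //; apply: hull_sub.
case: (proj1 (hexle_simple vY) hZY) => eY; [left|right]; congr cen.
  apply: (repr_inj hZ); rewrite eZ eY.
  by have -> : iter n arot alcove0 = alcove0; [elim: (n) => //= m -> | apply: repr_id].
by rewrite -ey1; apply: (repr_inj hZ); rewrite eZ eY -eSw -eB.
Qed.

End HexlePolygon.

(** * Interiors of stars *)

Section Stars.
Variables (R : realType) (P : rootsA2 R).

Local Notation E := 'rV[R]_2.
Local Notation delta := (delta P).
Local Notation sigma := (sigma P).
Local Notation U := (U P).
Local Notation V := (V P).
Local Notation pt := (pt P).

Lemma dot_continuous (u : E) : continuous (dot u : E -> R).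
Proof.
have -> : dot u = (fun v : E => u ord0 ord0 * v ord0 ord0 + u ord0 ord_max * v ord0
  ord_max).
  by apply/funext => v; rewrite dotE.
move=> v; apply: (@cvgD _ _ _ (nbhs v)); apply: (@cvgMl_tmp _ _ (nbhs v));
  exact: coord_continuous.
Qed.

Lemma delta_continuous : continuous delta.
Proof.
move=> v; apply: (@cvgD _ _ _ (nbhs v)); apply: (@cvgZr_tmp _ _ _ (nbhs v));
  last exact: dot_continuous.
by apply: (@cvgN _ _ _ (nbhs v)); apply: (@cvgD _ _ _ (nbhs v)); [apply:
  dot_continuous | apply: cvg_cst].
Qed.

Lemma sigma_continuous : continuous sigma.
Proof.
move=> v; apply: (@cvgB _ _ _ (nbhs v)); last exact: cvg_id.
apply: (@cvgZr_tmp _ _ _ (nbhs v)); apply: (@cvgMr_tmp _ _ (nbhs v)); apply: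
  (@cvgMl_tmp _ _ (nbhs v)); exact: dot_continuous.
Qed.

Lemma UV_continuous (m n c : R) : continuous (fun v => m * U v + n * V v + c : R).
Proof.
have cU : continuous (U : E -> R).
  move=> v; apply: (@cvgD _ _ _ (nbhs v)); last exact: cvg_cst.
  apply: (@cvgD _ _ _ (nbhs v)); last exact: dot_continuous.
  by apply: (@cvgMl_tmp _ _ (nbhs v)); apply: dot_continuous.
have cV : continuous (V : E -> R).
  move=> v; apply: (@cvgD _ _ _ (nbhs v)); last exact: cvg_cst.
  apply: (@cvgD _ _ _ (nbhs v)); first exact: dot_continuous.
  by apply: (@cvgMl_tmp _ _ (nbhs v)); apply: dot_continuous.
move=> v; apply: (@cvgD _ _ _ (nbhs v)); last exact: cvg_cst.
by apply: (@cvgD _ _ _ (nbhs v)); apply: (@cvgMl_tmp _ _ (nbhs v)); [apply: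
  cU | apply: cV].
Qed.

(** The two triangles of a star, scaled by 3: p, q, r encode the centres and c, c' the sizes. Both
    triangles share p, q, r because sigma exchanges their centres. *)
Definition region (p q r c c' : R) : set E := [set v |
  [/\ U v + p <= c, - V v + q <= c & V v - U v + r <= c] \/
  [/\ V v + p <= c', - U v + q <= c' & U v - V v + r <= c']].

Definition region_int (p q r c c' : R) (v : E) : Prop :=
  [/\ U v + p < c, - V v + q < c & V v - U v + r < c] \/
  [/\ V v + p < c', - U v + q < c' & U v - V v + r < c'].

Lemma open_halfplane (m n d c : R) : open [set v | m * U v + n * V v + d < c].
Proof.
apply: (@open_comp _ _ (fun v => m * U v + n * V v + d : R) [set x | x < c]).
  by move=> v _; apply: UV_continuous.
exact: open_lt.
Qed.

Lemma open_region_int p q r c c' : open [set v | region_int p q r c c' v].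
Proof.
have -> : [set v | region_int p q r c c' v] =
   ([set v | 1 * U v + 0 * V v + p < c] `&` [set v | 0 * U v + (-1) * V v + q < c] `&`
    [set v | (-1) * U v + 1 * V v + r < c]) `|`
   ([set v | 0 * U v + 1 * V v + p < c'] `&` [set v | (-1) * U v + 0 * V v + q < c'] `&`
    [set v | 1 * U v + (-1) * V v + r < c']).
  apply/seteqP; split=> v; rewrite /region_int /=.
    by case=> -[? ? ?]; [left|right]; (split; first split); lra.
  by case=> -[[? ?] ?]; [left|right]; split; lra.
by apply: openU; do 2?[apply: openI]; apply: open_halfplane.
Qed.

Lemma interior_push (A : set E) (v d : E) : interior A v ->
  exists2 t : R, 0 < t & A (v + t *: d).
Proof.
move=> Av; have cf : {for 0, continuous (fun t : R => v + t *: d)}.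
  by apply: cvgD; [apply: cvg_cst | apply: scalel_continuous].
have : nbhs (0 : R) ((fun t : R => v + t *: d) @^-1` A).
  by apply: cf; rewrite /= scale0r addr0.
case/nbhs_ballP => e /= e0 he; exists (e / 2); first by rewrite divr_gt0.
by apply: he; rewrite /ball /= sub0r normrN gtr0_norm ?divr_gt0 // ltr_pdivrMr //; lra.
Qed.

(* Unless two boundary normals, one of each triangle, are opposite, some
   direction leaves both triangles at once. *)
Lemma interior_region p q r c c' v : p + q < c + c' -> r + r < c + c' ->
  interior (region p q r c c') v <-> region_int p q r c c' v.
Proof.
move=> hpq hr; split=> [hv|hv]; last first.
  have sub : [set v | region_int p q r c c' v] `<=` region p q r c c'.
    by move=> z [] [? ? ?]; [left|right]; split; apply: ltW.
  by move: sub; rewrite (open_subsetE _ (@open_region_int p q r c c')); apply.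
have push du dv : exists2 t : R, 0 < t &
    ([/\ U v + t * du + p <= c, - (V v + t * dv) + q <= c &
         V v + t * dv - (U v + t * du) + r <= c] \/
     [/\ V v + t * dv + p <= c', - (U v + t * du) + q <= c' &
         U v + t * du - (V v + t * dv) + r <= c']).
  have [t t0 ht] := interior_push (pt du dv - pt 0 0) hv; exists t => //.
  have eU : U (v + t *: (pt du dv - pt 0 0)) = U v + t * du.
    have -> : U (v + t *: (pt du dv - pt 0 0)) = U v + t * (U (pt du dv) - U (pt 0 0)).
      by rewrite /U !(dotDr, dotZr, dotNr); ring.
    by rewrite !U_pt subr0.
  have eV : V (v + t *: (pt du dv - pt 0 0)) = V v + t * dv.
    have -> : V (v + t *: (pt du dv - pt 0 0)) = V v + t * (V (pt du dv) - V (pt 0 0)).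
      by rewrite /V !(dotDr, dotZr, dotNr); ring.
    by rewrite !V_pt subr0.
  by move: ht; rewrite /region /= eU eV.
apply: contrapT => nint.
have n1s : c <= U v + p \/ c <= - V v + q \/ c <= V v - U v + r.
  have [?|?] := leP c (U v + p); first by left.
  have [?|?] := leP c (- V v + q); first by right; left.
  have [?|?] := leP c (V v - U v + r); first by right; right.
  by case: nint; left.
have n2s : c' <= V v + p \/ c' <= - U v + q \/ c' <= U v - V v + r.
  have [?|?] := leP c' (V v + p); first by left.
  have [?|?] := leP c' (- U v + q); first by right; left.
  have [?|?] := leP c' (U v - V v + r); first by right; right.
  by case: nint; right.
(* The violated sides have opposite normals in three of the nine cases; there the size hypotheses
   exclude a common violation. In the other six, the direction given to [push] increases both
   left-hand sides. *)
case: n1s => [n1|[n1|n1]]; case: n2s => [n2|[n2|n2]].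
- by have [t t0 []] := push 1 1 => -[? ? ?]; lra.
- by lra.
- by have [t t0 []] := push 1 0 => -[? ? ?]; lra.
- by lra.
- by have [t t0 []] := push (-1) (-1) => -[? ? ?]; lra.
- by have [t t0 []] := push 0 (-1) => -[? ? ?]; lra.
- by have [t t0 []] := push 0 1 => -[? ? ?]; lra.
- by have [t t0 []] := push (-1) 0 => -[? ? ?]; lra.
- by lra.
Qed.

End Stars.

(** * Stars of alcoves and the order above x *)

Section StarAlcoves.
Variables (R : realType) (P : rootsA2 R).

Local Notation E := 'rV[R]_2.
Local Notation w1 := (varpi1 P).
Local Notation w2 := (varpi2 P).
Local Notation delta := (delta P).
Local Notation sigma := (sigma P).
Local Notation repr := (repr P).
Local Notation cen := (cen P).
Local Notation U := (U P).
Local Notation V := (V P).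
Local Notation region := (region P).

Lemma dot_w1 v : dot w1 v = (U v - 1) / 3.
Proof. by rewrite varpi1E dotC dotDr !dotZr !(dotC v) /U; field. Qed.

Lemma dot_w2 v : dot w2 v = (V v - 1) / 3.
Proof. by rewrite varpi2E dotC dotDr !dotZr !(dotC v) /V; field. Qed.

Lemma max3_le (x y z t : R) :
  Num.max x (Num.max y z) <= t <-> [/\ x <= t, y <= t & z <= t].
Proof.
by rewrite !ge_max; split=> [/andP[-> /andP[-> ->]]|[-> -> ->]].
Qed.

Lemma M1E u : M1 P u = Num.max ((U u - 1) / 3) (Num.max ((1 - V u) / 3) ((V u - U
  u) / 3)).
Proof.
rewrite /M1 -!dot_w1; congr (Num.max _ (Num.max _ _)).
  by rewrite dotC dotNr dotC dot_w2; field.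
by rewrite dotC dotBr !(dotC u) dot_w1 dot_w2; field.
Qed.

Lemma M2E u : M2 P u = Num.max ((V u - 1) / 3) (Num.max ((1 - U u) / 3) ((U u - V
  u) / 3)).
Proof.
rewrite /M2 -!dot_w2; congr (Num.max _ (Num.max _ _)).
  by rewrite dotC dotNr dotC dot_w1; field.
by rewrite dotC dotBr !(dotC u) dot_w1 dot_w2; field.
Qed.

Lemma U_shift v c : U (v - c) = U v - U c + 1.
Proof. by rewrite /U !dotBr; ring. Qed.

Lemma V_shift v c : V (v - c) = V v - V c + 1.
Proof. by rewrite /V !dotBr; ring. Qed.

Lemma UV_w1 : U (- w1) = -1 /\ V (- w1) = 0.
Proof. by rewrite /U /V !dotNr !(dotC _ w1) dot_varpi11 dot_varpi12; split; ring. Qed.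

Lemma UV_w2 : U (- w2) = 0 /\ V (- w2) = -1.
Proof. by rewrite /U /V !dotNr !(dotC _ w2) dot_varpi21 dot_varpi22; split; ring. Qed.

Lemma UV_0 : U 0 = 1 /\ V 0 = 1.
Proof. by rewrite /U /V !dot0r; split; ring. Qed.

(** Unlike [in_strip], the second disjunct admits the alcove of s_0, whose star is also centred at
    0. *)
Definition opposite (A : alcove) : bool :=
  antidominant A || [&& c1 A == 0, c2 A <= 0 & 1 <= c3 A].

Definition alcove_star0 (A : alcove) (v : E) : Prop :=
  (dominant A /\
   region 1 0 (-1) (c1 A - c3 A + 1)%:~R (c2 A - c3 A + 1)%:~R v) \/
  (opposite A /\
   region (-1) 1 0 (c3 A - c2 A + 1)%:~R (c3 A - c1 A + 1)%:~R v).

Lemma triangles_dominant x A v : repr x A -> dominant A ->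
  (triangle_l P (- w1) (cen x) `|` triangle_r P (- w2) (cen x)) v <->
  region 1 0 (-1) (c1 A - c3 A + 1)%:~R (c2 A - c3 A + 1)%:~R v.
Proof.
move=> hA dA; have vA : valid A by case: hA.
have [uA wA] := UV_cen hA; have [uw1 vw1] := UV_w1; have [uw2 vw2] := UV_w2.
have [i1 i2] : (- (c2 A - c3 A) <= c1 A - c3 A + 1) /\
    (c2 A - c3 A - (c1 A - c3 A) <= c1 A - c3 A + 2).
  by move: vA dA; rewrite /valid /dominant; lia.
have [i3 i4] : (- (c1 A - c3 A) <= c2 A - c3 A + 1) /\
    (c1 A - c3 A - (c2 A - c3 A) <= c2 A - c3 A + 2).
  by move: vA dA; rewrite /valid /dominant; lia.
move: i1 i2 i3 i4; rewrite -!(ler_int R) !(intrD, intrB, intrN) => i1 i2 i3 i4.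
move: uA wA; rewrite !intrB => uA wA.
(* The bounds i1, i2 say that the term of varpi_1 attains the maximum at the centre of a dominant
   alcove. *)
have eM1 : M1 P (cen x - - w1) = (U (cen x) + 1) / 3.
  by rewrite M1E U_shift V_shift uw1 vw1; apply/eqP; rewrite eq_le;
    apply/andP; split; [apply/max3_le; split; lra | rewrite le_max; apply/orP;
      left; lra].
have eM2 : M2 P (cen x - - w2) = (V (cen x) + 1) / 3.
  by rewrite M2E U_shift V_shift uw2 vw2; apply/eqP; rewrite eq_le;
    apply/andP; split; [apply/max3_le; split; lra | rewrite le_max; apply/orP;
      left; lra].
rewrite /setU /triangle_l /triangle_r /= eM1 eM2 M1E M2E !max3_le !U_shift !V_shift.
rewrite uw1 uw2 vw1 vw2 /region /=.
by split=> -[] [? ? ?]; [left|right|left|right]; split; lra.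
Qed.

Lemma triangles_opposite x A v : repr x A -> opposite A ->
  (triangle_l P 0 (cen x) `|` triangle_r P 0 (cen x)) v <->
  region (-1) 1 0 (c3 A - c2 A + 1)%:~R (c3 A - c1 A + 1)%:~R v.
Proof.
move=> hA dA; have vA : valid A by case: hA.
have [uA wA] := UV_cen hA; have [u0 v0] := UV_0.
have [i1 i2] : (c1 A - c3 A - 1 <= c3 A - c2 A + 1) /\
    (c2 A - c3 A - (c1 A - c3 A) <= c3 A - c2 A + 1).
  by move: vA dA; rewrite /valid /opposite /antidominant; lia.
have [i3 i4] : (c2 A - c3 A - 1 <= c3 A - c1 A + 1) /\
    (c1 A - c3 A - (c2 A - c3 A) <= c3 A - c1 A + 1).
  by move: vA dA; rewrite /valid /opposite /antidominant; lia.
move: i1 i2 i3 i4; rewrite -!(ler_int R) !(intrD, intrB, intrN) => i1 i2 i3 i4.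
move: uA wA; rewrite !intrB => uA wA.
have eM1 : M1 P (cen x - 0) = (1 - V (cen x)) / 3.
  rewrite M1E U_shift V_shift u0 v0; apply/eqP; rewrite eq_le.
  apply/andP; split; first by apply/max3_le; split; lra.
  by rewrite !le_max; apply/orP; right; apply/orP; left; lra.
have eM2 : M2 P (cen x - 0) = (1 - U (cen x)) / 3.
  rewrite M2E U_shift V_shift u0 v0; apply/eqP; rewrite eq_le.
  apply/andP; split; first by apply/max3_le; split; lra.
  by rewrite !le_max; apply/orP; right; apply/orP; left; lra.
rewrite /setU /triangle_l /triangle_r /= eM1 eM2 M1E M2E !max3_le !U_shift !V_shift.
rewrite u0 v0 /region /=.
by split=> -[] [? ? ?]; [left|right|left|right]; split; lra.
Qed.

Lemma star0P x A v : repr x A -> star0 P x v <-> alcove_star0 A v.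
Proof.
move=> hA; split=> [[u Dx|u Nx]|[[dA]|[oA]]].
- by have dA := proj1 (D_repr hA) Dx; move/(triangles_dominant _ hA dA); left.
- have oA : opposite A.
    by case: Nx => [/(s0D_repr hA)|/(strip_repr hA)]; rewrite /opposite => ->;
      rewrite ?orbT.
  by move/(triangles_opposite _ hA oA); right.
- by move/(triangles_dominant _ hA dA); apply: star0_D; apply/(D_repr hA).
- move/(triangles_opposite _ hA oA); apply: star0_s0D.
  by case/orP: oA => [/(s0D_repr hA)|/(strip_repr hA)]; [left|right].
Qed.

Definition eact (n : nat) (b : bool) (v : E) :
  E := iter n delta (if b then sigma v else v).

Definition aact (n : nat) (b : bool) (A : alcove) : alcove :=
  iter n arot (if b then aswap A else A).

Lemma conjf_comp (f f' g g' : E -> E) w : cancel f f' -> cancel f' f ->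
  cancel g g' -> cancel g' g -> conjf (f \o g) w = conjf f (conjf g w).
Proof.
move=> fK f'K gK g'K; rewrite /conjf (invf_can fK f'K) (invf_can gK g'K).
rewrite (@invf_can _ (f \o g) (g' \o f')) // => v /=; first by rewrite fK gK.
by rewrite g'K f'K.
Qed.

Lemma eact_bij n b : exists h, cancel (eact n b) h /\ cancel h (eact n b).
Proof.
elim: n => [|n [h [gK hK]]].
  exists (if b then sigma else id).
  by rewrite /eact; case: b; split=> v /=; rewrite ?sigmaK.
exists (h \o (delta \o delta)); rewrite /eact /=; split=> v /=.
  by rewrite delta_order3; apply: gK.
by rewrite -[iter n _ _]/(eact n b _) hK delta_order3.
Qed.

Lemma repr_eact n b w A : repr w A -> repr (conjf (eact n b) w) (aact n b A).
Proof.
move=> hA; elim: n => [|n IH].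
  rewrite /eact /aact; case: b => /=; first exact: repr_sigma.
  have -> : conjf (fun v => v) w = w; last by [].
  by rewrite /conjf (@invf_can _ (fun v => v) id).
have [h [gK hK]] := eact_bij n b.
have -> : conjf (eact n.+1 b) w = conjf delta (conjf (eact n b) w).
  apply: (@conjf_comp delta (delta \o delta) (eact n b) h) => // v /=;
  by rewrite delta_order3.
exact: (repr_delta IH).
Qed.

Lemma isoms_act g : isoms P g -> exists n b, (n < 3)%N /\ g = eact n b.
Proof.
elim=> [|f {}g Sf _ [n [b [n3 ->]]]]; first by exists 0%N, false.
case: Sf => ->.
  case: n n3 => [|[|[|]]] // _; [exists 1%N, b|exists 2%N, b|exists 0%N, b] => //.
  by split=> //; apply/funext => v; rewrite /eact /= delta_order3.
case: n n3 => [|[|[|]]] // _; [exists 0%N|exists 2%N|exists 1%N];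
  exists (~~ b); split=> //; apply/funext => v; rewrite /eact /=; case: b => /=.
- by rewrite sigmaK.
- by [].
- by rewrite sigma_delta sigmaK.
- by rewrite sigma_delta.
- by rewrite 2!sigma_delta sigmaK delta_order3.
- by rewrite 2!sigma_delta delta_order3.
Qed.

Lemma isoms_eact n b : isoms P (eact n b).
Proof.
elim: n => [|n IH].
  rewrite /eact; case: b => /=; last exact: generated_id.
  by apply: (@generated_comp _ _ sigma id); [right | apply: generated_id].
by apply: (@generated_comp _ _ delta (eact n b)) => //; left.
Qed.

Definition alcove_star (X : alcove) : set E :=
  [set v | exists n b, (n < 3)%N /\ alcove_star0 (aact n b X) (eact n b v)].

Lemma star_repr x X : repr x X -> star P x = alcove_star X.
Proof.
move=> hX; apply/seteqP; split=> v.
  move=> [g /isoms_act[n [b [n3 ->]]]] /=.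
  by move/(star0P _ (repr_eact n b hX)) => h; exists n, b.
move=> [n [b [n3 h]]]; exists (eact n b); first exact: isoms_eact.
by apply/(star0P _ (repr_eact n b hX)).
Qed.

Lemma arot3 A : arot (arot (arot A)) = A.
Proof. by case: A. Qed.

Lemma aswapK A : aswap (aswap A) = A.
Proof. by case: A. Qed.

Lemma aswap_rot A : aswap (arot A) = arot (arot (aswap A)).
Proof. by case: A. Qed.

Lemma alcove_star_sub X Y (f : E -> E) n b n' b' v : (n' < 3)%N ->
  aact n' b' Y = aact n b X -> eact n' b' (f v) = eact n b v ->
  alcove_star0 (aact n b X) (eact n b v) -> (f @^-1` alcove_star Y) v.
Proof. by move=> n'3 <- <- h; exists n', b'. Qed.

Lemma alcove_star_sup X Y (f : E -> E) n b n' b' v : (n' < 3)%N ->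
  aact n' b' Y = aact n b X -> eact n' b' v = eact n b (f v) ->
  alcove_star0 (aact n b X) (eact n b (f v)) -> alcove_star Y v.
Proof. by move=> n'3 <- <- h; exists n', b'. Qed.

Lemma act_delta n b X v : (n < 3)%N -> exists n', [/\ (n' < 3)%N,
  aact n' b (arot X) = aact n b X & eact n' b (delta v) = eact n b v].
Proof.
case: b; case: n => [|[|[|//]]] _;
  [exists 1%N|exists 2%N|exists 0%N|exists 2%N|exists 0%N|exists 1%N];
  (split; [by [] | by rewrite /aact /= ?aswap_rot ?arot3 | rewrite /eact /=]).
- by rewrite sigma_delta delta_order3.
- by rewrite sigma_delta delta_order3.
- by rewrite sigma_delta.
- by rewrite delta_order3.
- by [].
- by [].
Qed.

Lemma act_delta_inv n b X v : (n < 3)%N -> exists n', [/\ (n' < 3)%N,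
  aact n' b X = aact n b (arot X) & eact n' b v = eact n b (delta v)].
Proof.
case: b; case: n => [|[|[|//]]] _;
  [exists 2%N|exists 0%N|exists 1%N|exists 1%N|exists 2%N|exists 0%N];
  (split; [by [] | by rewrite /aact /= ?aswap_rot ?arot3 | rewrite /eact /=]).
- by rewrite sigma_delta.
- by rewrite sigma_delta (delta_order3 P (sigma v)).
- by rewrite sigma_delta (delta_order3 P (delta (sigma v))).
- by [].
- by [].
- by rewrite (delta_order3 P v).
Qed.

Lemma alcove_star_rot X : alcove_star X = delta @^-1` alcove_star (arot X).
Proof.
apply/seteqP; split=> v [n [b [n3]]].
  have [n' [n'3 e1 e2]] := act_delta b X v n3; exact: alcove_star_sub e1 e2.
have [n' [n'3 e1 e2]] := act_delta_inv b X v n3; exact: alcove_star_sup e1 e2.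
Qed.

Lemma alcove_star_swap X : alcove_star X = sigma @^-1` alcove_star (aswap X).
Proof.
apply/seteqP; split=> v [n [b [n3]]].
  apply: (alcove_star_sub (n' := n) (b' := ~~ b)) .
  - exact: n3.
  - by rewrite /aact; case: b; rewrite /= ?aswapK.
  - by rewrite /eact; case: b; rewrite /= ?sigmaK.
apply: (alcove_star_sup (n' := n) (b' := ~~ b)) .
- exact: n3.
- by rewrite /aact; case: b; rewrite /= ?aswapK.
- by rewrite /eact; case: b; rewrite /= ?sigmaK.
Qed.

Lemma interior_preimage (T T' : topologicalType) (f : T -> T') (g : T' -> T) (A :
  set T') v :
  cancel f g -> cancel g f -> continuous f -> continuous g ->
  interior (f @^-1` A) v <-> interior A (f v).
Proof.
move=> fK gK cf cg; split=> [h|]; last exact: cf.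
have -> : A = g @^-1` (f @^-1` A).
  by apply/seteqP; split=> u; rewrite /preimage /= gK.
by apply: cg; rewrite /= fK.
Qed.

(** Of the six isometries only id and sigma bring X into the domain of [alcove_star0], and sigma
    merely exchanges the two triangles; the union over isometries is therefore a single region. *)
Lemma alcove_star_dominant X : dominant X -> alcove_star X =
  region 1 0 (-1) (c1 X - c3 X + 1)%:~R (c2 X - c3 X + 1)%:~R.
Proof.
case: X => a b c dX; apply/seteqP; split=> v; last first.
  by move=> h; exists 0%N, false; split=> //; left.
move: dX; rewrite /dominant /= => dX [n [s [n3]]]; rewrite /alcove_star0.
case: n n3 => [|[|[|]]] // _; case: s; rewrite /aact /eact /=.
- move=> [[_ h] | [d _]]; last first.
    by exfalso; move: d; rewrite /opposite /antidominant /=; clear -dX; lia.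
  by move: h; rewrite /region /= U_sigma V_sigma => -[h|h]; [right|left].
- move=> [[_ h] | [d _]]; first exact: h.
  by exfalso; move: d; rewrite /opposite /antidominant /=; clear -dX; lia.
all: move=> [[d _] | [d _]]; exfalso; move: d;
  by rewrite /dominant /opposite /antidominant /=; clear -dX; lia.
Qed.

Lemma alcove_star_opposite X : opposite X -> alcove_star X =
  region (-1) 1 0 (c3 X - c2 X + 1)%:~R (c3 X - c1 X + 1)%:~R.
Proof.
case: X => a b c oX; apply/seteqP; split=> v; last first.
  by move=> h; exists 0%N, false; split=> //; right.
move: oX; rewrite /opposite /antidominant /= => oX [n [s [n3]]].
rewrite /alcove_star0.
case: n n3 => [|[|[|]]] // _; case: s; rewrite /aact /eact /=.
- move=> [[d _] | [_ h]].
    by exfalso; move: d; rewrite /dominant /=; clear -oX; lia.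
  by move: h; rewrite /region /= U_sigma V_sigma => -[h|h]; [right|left].
- move=> [[d _] | [_ h]]; last exact: h.
  by exfalso; move: d; rewrite /dominant /=; clear -oX; lia.
all: move=> [[d _] | [d _]]; exfalso; move: d;
  by rewrite /dominant /opposite /antidominant /=; clear -oX; lia.
Qed.

Lemma region_int_int (p q r c c' : int) v (m n : int) : U v = m%:~R -> V v = n%:~R ->
  region_int P p%:~R q%:~R r%:~R c%:~R c'%:~R v <->
  [/\ m + p < c, - n + q < c & n - m + r < c] \/
  [/\ n + p < c', - m + q < c' & m - n + r < c'].
Proof.
move=> eu ev; rewrite /region_int eu ev -!(intrN, intrB, intrD).
by rewrite !ltr_int.
Qed.

(** Negating the first inequality of a cycle makes its three alternatives fail together, which are
    the three strict sides of a triangle. In [hexle_from_opposite] the third inequality of each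
    cycle plays this part. *)
Lemma hexle_from_dominant X Z : valid X -> valid Z -> dominant X ->
  ~ hexle X Z <->
  [/\ c1 Z - c3 Z + 1 < c1 X - c3 X + 1, - (c2 Z - c3 Z) + 0 < c1 X - c3 X + 1 &
      c2 Z - c3 Z - (c1 Z - c3 Z) + -1 < c1 X - c3 X + 1] \/
  [/\ c2 Z - c3 Z + 1 < c2 X - c3 X + 1, - (c1 Z - c3 Z) + 0 < c2 X - c3 X + 1 &
      c1 Z - c3 Z - (c2 Z - c3 Z) + -1 < c2 X - c3 X + 1].
Proof.
case: X Z => [a b c] [a' b' c']; rewrite /valid /dominant /hexle /cyc_le /= !le_max.
move=> vX vZ dX; split=> [nh|]; last first.
  by move=> h [[h1 _] [h2 _]]; case: h => -[? ? ?]; lia.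
apply: contrapT => no; apply: nh.
have {no} : ~~ [&& a' - c' + 1 < a - c + 1, - (b' - c') + 0 < a - c + 1 &
      b' - c' - (a' - c') + -1 < a - c + 1] /\
   ~~ [&& b' - c' + 1 < b - c + 1, - (a' - c') + 0 < b - c + 1 &
      a' - c' - (b' - c') + -1 < b - c + 1].
  by split; apply/negP => /and3P h; apply: no; [left|right].
case=> n1 n2; do !split; lia.
Qed.

Lemma hexle_from_opposite X Z : valid X -> valid Z -> opposite X ->
  ~ hexle X Z <->
  [/\ c1 Z - c3 Z + -1 < c3 X - c2 X + 1, - (c2 Z - c3 Z) + 1 < c3 X - c2 X + 1 &
      c2 Z - c3 Z - (c1 Z - c3 Z) + 0 < c3 X - c2 X + 1] \/
  [/\ c2 Z - c3 Z + -1 < c3 X - c1 X + 1, - (c1 Z - c3 Z) + 1 < c3 X - c1 X + 1 &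
      c1 Z - c3 Z - (c2 Z - c3 Z) + 0 < c3 X - c1 X + 1].
Proof.
case: X Z => [a b c] [a' b' c']; rewrite /valid /opposite /antidominant /hexle
  /cyc_le /= !le_max.
move=> vX vZ dX; split=> [nh|]; last first.
  by move=> h [[_ [_ h1]] [_ [_ h2]]]; case: h => -[? ? ?]; lia.
apply: contrapT => no; apply: nh.
have {no} : ~~ [&& a' - c' + -1 < c - b + 1, - (b' - c') + 1 < c - b + 1 &
      b' - c' - (a' - c') + 0 < c - b + 1] /\
   ~~ [&& b' - c' + -1 < c - a + 1, - (a' - c') + 1 < c - a + 1 &
      a' - c' - (b' - c') + 0 < c - a + 1].
  by split; apply/negP => /and3P h; apply: no; [left|right].
case=> n1 n2; do !split; lia.
Qed.

(** The point is given by its coordinates rather than as a centre, so that the induction over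
    symmetries applies directly to its images under delta and sigma. *)
Lemma alcove_star_hexle X Z v : valid X -> X <> alcove0 -> valid Z ->
  U v = (c1 Z - c3 Z)%:~R -> V v = (c2 Z - c3 Z)%:~R ->
  interior (alcove_star X) v <-> ~ hexle X Z.
Proof.
move=> vX; move: X vX Z v; apply: alcove_sym_ind => X vX.
- move=> IH Z v X0 vZ eu ev; rewrite alcove_star_rot.
  have d3 : cancel delta (delta \o delta) by move=> u /=; rewrite delta_order3.
  have d3' : cancel (delta \o delta) delta by move=> u /=; rewrite delta_order3.
  have cdd : continuous (delta \o delta).
    by move=> u; apply: continuous_comp; apply: delta_continuous.
  rewrite (interior_preimage _ _ d3 d3' (@delta_continuous _ P) cdd).
  rewrite (IH (arot Z)) ?valid_rot ?hexle_rot //.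
  + by move=> e; apply: X0; rewrite -(arot3 X) e.
  + by rewrite U_delta ev -intrN; case: (Z) => ? ? ? /=; congr (_%:~R); lia.
  + by rewrite V_delta eu ev -intrB; case: (Z) => ? ? ? /=; congr (_%:~R); lia.
- move=> IH Z v X0 vZ eu ev; rewrite alcove_star_swap.
  rewrite (interior_preimage _ _ (@sigmaK _ P) (@sigmaK _ P)
    (@sigma_continuous _ P) (@sigma_continuous _ P)).
  rewrite (IH (aswap Z)) ?valid_swap ?hexle_swap //.
  + by move=> e; apply: X0; rewrite -(aswapK X) e.
  + by rewrite U_sigma ev; case: (Z).
  + by rewrite V_sigma eu; case: (Z).
move=> sX Z v X0 vZ eu ev.
have [dX|oX] : dominant X \/ opposite X.
  case/or4P: sX => sX; [by left | by right; rewrite /opposite sX | |].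
    by right; move: sX; rewrite /opposite /in_strip; lia.
  case/and3P: sX => h1 h2 /orP[] h3.
    by case: X0; apply: alcoveP => /=; apply/eqP.
  by right; move: h1 h2 h3; rewrite /opposite; lia.
- rewrite alcove_star_dominant // interior_region; first last.
  + by rewrite -[1]/(1%:~R) -[-1]/((-1)%:~R) -!intrD ltr_int; move: dX vX;
      rewrite /dominant /valid; lia.
  + by rewrite -[1]/(1%:~R) -[0]/(0%:~R) -!intrD ltr_int; move: dX vX;
      rewrite /dominant /valid; lia.
  rewrite -[1]/(1%:~R) -[0]/(0%:~R) -[-1]/((-1)%:~R) (region_int_int _ _ _ _ _ eu ev).
  by rewrite hexle_from_dominant.
- rewrite alcove_star_opposite // interior_region; first last.
  + by rewrite -[0]/(0%:~R) -!intrD ltr_int; move: oX vX;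
      rewrite /opposite /antidominant /valid; lia.
  + by rewrite -[1]/(1%:~R) -[-1]/((-1)%:~R) -!intrD ltr_int; move: oX vX;
      rewrite /opposite /antidominant /valid; lia.
  rewrite -[1]/(1%:~R) -[0]/(0%:~R) -[-1]/((-1)%:~R) (region_int_int _ _ _ _ _ eu ev).
  by rewrite hexle_from_opposite.
Qed.

End StarAlcoves.

Theorem theoremA (R : realType) (P : rootsA2 R) (x y : 'rV[R]_2 -> 'rV[R]_2)
    (hx : W P x) (hy : W P y) (x_neq_id : x <> id) :
  bruhat_interval P x y =
    [set z | [/\ W P z, polygon P y (cen P z) & ~ interior (star P x) (cen P z)]].
Proof.
have [X hX] := proj1 (W_repr P x) hx; have [Y hY] := proj1 (W_repr P y) hy.
have X0 : X <> alcove0.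
  by move=> e; apply: x_neq_id; apply: (repr_inj hX); rewrite e; apply: repr_id.
have star_bruhat z Z : repr P z Z ->
    interior (star P x) (cen P z) <-> ~ bruhat P x z.
  move=> hZ; have [uZ vZ] := UV_cen hZ; rewrite (bruhat_hexle hX hZ) (star_repr hX).
  by case: hX hZ => vX _ _ _ _ [wZ _ _ _ _]; apply: alcove_star_hexle.
apply/seteqP; split=> z [Wz h1 h2]; have [Z hZ] := proj1 (W_repr P z) Wz.
  split=> //; first exact: (hexle_polygon hY hZ (proj1 (bruhat_hexle hZ hY) h2)).
  by move/(star_bruhat _ _ hZ); apply.
split=> //; first by apply: contrapT => n; apply/h2/(star_bruhat _ _ hZ).
exact/(bruhat_hexle hZ hY)/(polygon_hexle hY hZ).
Qed.
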